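(* Let $f:C\to E$ be the bielliptic cover described in the context, let $\mathcal L=\mathcal O_C(\tilde q_1+\tilde q_2-\infty_+-\infty_-)$ with $\tilde q_i=(\xi_i,y_i)\in C$ ($i=1,2$), and let $\nabla_{\mathcal L}=d+\omega$ be a regular connection on $\mathcal L$ with connection form (in the meromorphic trivialization $1$ of $\mathcal L$) $$\omega=\frac12\left(\frac{y+y_1}{\xi-\xi_1}+\frac{y+y_2}{\xi-\xi_2}\right)\frac{d\xi}{y}+\lambda_1\frac{d\xi}{y}+\lambda_2\frac{\xi\,d\xi}{y}\qquad(\lambda_1,\lambda_2\in\mathbb C).$$ Assume that $\xi_i\neq0$, that is, $\tilde q_i\neq\tilde p_\pm$. Then the direct image $\nabla_{\mathcal E}=f_*(\nabla_{\mathcal L})$ is a logarithmic connection on a rank-$2$ vector bundle $\mathcal E$ $(=f_*\mathcal L)$ over $E$ whose only poles are the two branch points $p_\pm$ of $f$. In the meromorphic trivialization of $\mathcal E$ defined by $(1,\xi)$, $\nabla_{\mathcal E}=d+A$ where, with $x_i=t'-\xi_i^2$, the matrix $A=(A_{ij})$ has entries $$A_{11}=-\tfrac12\left(\tfrac12\left(\tfrac{y+y_1}{x_1-x}+\tfrac{y+y_2}{x_2-x}\right)+\lambda_2\right)\frac{dx}{y},$$ $$A_{12}=-\tfrac12\left(\tfrac12\left(\tfrac{(y+y_1)\xi_1}{x_1-x}+\tfrac{(y+y_2)\xi_2}{x_2-x}\right)+\lambda_1\right)\frac{dx}{y},$$ $$A_{21}=-\tfrac12\left(\tfrac12\left(\tfrac{(y+y_1)\xi_1}{(x_1-x)(t'-x)}+\tfrac{(y+y_2)\xi_2}{(x_2-x)(t'-x)}\right)+\tfrac{\lambda_1}{t'-x}\right)\frac{dx}{y},$$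 $$A_{22}=-\tfrac12\left(\tfrac12\left(\tfrac{y+y_1}{x_1-x}+\tfrac{y+y_2}{x_2-x}\right)+\lambda_2+\tfrac{y}{t'-x}\right)\frac{dx}{y},$$ and the residues at $p_\pm$ are given by $$\operatorname{Res}_{p_\pm}A=\begin{pmatrix}0&0\\ \frac14\left(\frac{(y_1\pm y_0)\xi_1}{x_1-t'}+\frac{(y_2\pm y_0)\xi_2}{x_2-t'}\right)\pm\frac{\lambda_1}{2y_0}&\frac12\end{pmatrix}.$$
   Context: Let $t,t'\in\mathbb C\setminus\{0,1\}$, $t\neq t'$. $E$ is the elliptic curve (smooth projective model) $y^2=x(x-1)(x-t)$, with point at infinity $\infty$; $C$ is the genus-$2$ curve (smooth projective model) $y^2=(t'-\xi^2)(t'-1-\xi^2)(t'-t-\xi^2)$; $f:C\to E$ is the degree-$2$ map $(\xi,y)\mapsto(x,y)=(t'-\xi^2,y)$; $f^{-1}(\infty)=\{\infty_+,\infty_-\}$. Let $y_0=\sqrt{t'(t'-1)(t'-t)}$; the branch points of $f$ are $p_\pm=(t',\pm y_0)\in E$ and the ramification points are $\tilde p_\pm=(0,\pm y_0)\in C$. Vector bundles are identified with locally free sheaves. The matrix $(a_{ij})$ of a connection $\nabla$ in a (meromorphic) basis $(e_1,e_2)$ is defined by $\nabla(e_j)=\sum_i a_{ij}e_i$; poles of this matrix at points where the basis fails to be a holomorphic frame are not counted as poles of the connection unless they persist in a local holomorphic frame. A meromorphic connection is logarithmic if its matrix in local holomorphic frames has at most simple poles. The direct image of $\nabla_{\mathcal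 L}$ is the induced meromorphic connection on the sheaf-theoretic direct image $f_*\mathcal L$.
   Formalization: In the lower-left entry of the residue matrix at p_±, the factor 1/4 before the bracketed sum is corrected to ±1/(4y_0), as the formula for A_21 requires; the printed value fails e.g. for t=-1, t'=2, q_1=q_2=(1,0), λ_1=λ_2=0. *)

(* Defs.v *)
(* Algebraic curves y^2 = P(x) with their sheaves and connections, in algebraic
   form: on a smooth projective curve the meromorphic functions are the rational
   ones; sheaves are Zariski sheaves, realised as subsheaves of constant
   sheaves; a meromorphic connection is given by its action on rational
   sections.  The base field is an algebraically closed field with complex
   conjugation, for instance R[i] with R : realType. *)
From HB Require Import structures.
From mathcomp Require Import all_boot all_order all_algebra all_field.
From mathcomp Require Import complex.
From mathcomp Require Import all_classical all_reals.
From mathcomp Require Import generic_quotient.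
From mathcomp Require Import polyXY.
From mathcomp Require Import ring zify.

Set Implicit Arguments.
Unset Strict Implicit.
Unset Printing Implicit Defensive.

Import Order.TTheory GRing.Theory Num.Theory.

Local Open Scope ring_scope.
Local Open Scope classical_set_scope.

Notation "x %:F" := (@FracField.tofrac _ x) : ring_scope.

Lemma subf_div (K : fieldType) (a b c d : K) : b != 0 -> d != 0 ->
  a / b - c / d = (a * d - c * b) / (b * d).
Proof. by move=> b0 d0; field; rewrite b0 d0. Qed.

Lemma half_quotient (K : fieldType) (a p : K) : 2%:R != 0 :> K -> p != 0 ->
  2%:R * (a / (2%:R * p)) * p = a.
Proof. by move=> n2 p0; field; rewrite n2 p0. Qed.

Section Fractions.
Variables (R : idomainType).
Implicit Types (r : {fraction R}) (a b : R).

Lemma numden_fraction r : r = (\n_(repr r))%:F / (\d_(repr r))%:F.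
Proof.
have d0 : (\d_(repr r))%:F != 0 by rewrite tofrac_eq0 denom_ratioP.
apply: (canRL (mulfK d0)).
move: d0; rewrite -[r in r * _]reprK; move: (repr r) => x d0.
unlock FracField.tofrac; rewrite -[LHS]FracField.pi_mul.
apply/eqmodP; rewrite /= FracField.equivfE /FracField.mulf.
by rewrite !numden_Ratio ?mulf_neq0 ?oner_neq0 ?denom_ratioP // !mulr1 mulrC.
Qed.

Lemma eq_fraction a b c d : b != 0 -> d != 0 ->
  (a%:F / b%:F == c%:F / d%:F) = (a * d == c * b).
Proof.
by move=> b0 d0; rewrite eqr_div ?tofrac_eq0 // -!rmorphM /= tofrac_eq.
Qed.

Lemma fraction_ind (P : {fraction R} -> Prop) :
  (forall a b, b != 0 -> P (a%:F / b%:F)) -> forall r, P r.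
Proof. by move=> Pab r; rewrite (numden_fraction r); apply: Pab; apply: denom_ratioP. Qed.
End Fractions.

Section FractionLift.
Variables (R : idomainType) (L : fieldType) (phi : {rmorphism R -> L}).

Definition fraction_lift (r : {fraction R}) : L :=
  phi \n_(repr r) / phi \d_(repr r).

Hypothesis phi_inj : injective phi.

Lemma fraction_liftE a b : b != 0 ->
  fraction_lift (a%:F / b%:F) = phi a / phi b.
Proof.
move=> b0; set r := _ / _; have d0 : \d_(repr r) != 0 by exact: denom_ratioP.
have := numden_fraction r; rewrite {1}/r => /eqP.
rewrite eq_fraction // => /eqP e.
have p0 c : c != 0 -> phi c != 0 by move=> c0; rewrite raddf_eq0.
by apply/eqP; rewrite eqr_div ?p0 // -!rmorphM e.
Qed.

Fact fraction_lift_additive : zmod_morphism fraction_lift.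
Proof.
elim/fraction_ind=> a b b0; elim/fraction_ind=> c d d0.
have bF : b%:F != 0 by rewrite tofrac_eq0.
have dF : d%:F != 0 by rewrite tofrac_eq0.
have -> : a%:F / b%:F - c%:F / d%:F = (a * d - c * b)%:F / (b * d)%:F.
  by rewrite rmorphB !rmorphM /= subf_div.
rewrite !fraction_liftE ?mulf_neq0 // rmorphB !rmorphM /=.
by rewrite subf_div ?raddf_eq0.
Qed.

Fact fraction_lift_multiplicative : monoid_morphism fraction_lift.
Proof.
split; first by have := fraction_liftE 1 (oner_neq0 R); rewrite tofrac1 !divr1 rmorph1 divr1.
elim/fraction_ind=> a b b0; elim/fraction_ind=> c d d0.
by rewrite mulf_div -!rmorphM /= !fraction_liftE ?mulf_neq0 // !rmorphM /= mulf_div.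
Qed.
End FractionLift.

HB.lock Definition ratderiv (F : fieldType) (r : {fraction {poly F}}) : {fraction {poly F}} :=
  let n := \n_(repr r) in let d := \d_(repr r) in
  (n^`() * d - n * d^`())%:F / (d ^+ 2)%:F.
Canonical ratderiv_unlockable := Unlockable ratderiv.unlock.

Section RatDeriv.
Variable F : fieldType.

Lemma ratderivE (a b : {poly F}) : b != 0 ->
  ratderiv (a%:F / b%:F) = (a^`() * b - a * b^`())%:F / (b ^+ 2)%:F.
Proof.
move=> b0; set r := _ / _; have d0 : \d_(repr r) != 0 by exact: denom_ratioP.
have := numden_fraction r; rewrite {1}/r => /eqP.
rewrite eq_fraction // => /eqP; rewrite ratderiv.unlock /=; move: d0.
set n := \n_ _; set d := \d_ _ => d0 e.
have e' := congr1 (@deriv _) e; rewrite !derivM in e'.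
apply/eqP; rewrite eq_fraction ?expf_neq0 //; apply/eqP.
have {e'} e2 : a^`() * d = n^`() * b + n * b^`() - a * d^`() by rewrite -e' addrK.
symmetry; transitivity ((a^`() * d) * (b * d) - (a * d) * (b^`() * d)); first by ring.
rewrite e2 [X in X - _](_ : _ =
  n^`() * b * (b * d) + n * b * (b^`() * d) - (a * d) * (d^`() * b)); last by ring.
by rewrite e; ring.
Qed.
End RatDeriv.

Section RatDerivTheory.
Variable F : fieldType.
Implicit Types (r s : {fraction {poly F}}) (a b : {poly F}).

Lemma ratderiv_tofrac a : ratderiv a%:F = (a^`())%:F.
Proof.
have := ratderivE a (oner_neq0 _); rewrite tofrac1 divr1 => ->.
by rewrite -polyC1 derivC mulr0 subr0 polyC1 expr1n tofrac1 mulr1 divr1.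
Qed.

Lemma ratderivD r s : ratderiv (r + s) = ratderiv r + ratderiv s.
Proof.
elim/fraction_ind: r => a b b0; elim/fraction_ind: s => c d d0.
rewrite addf_div ?tofrac_eq0 // -!(rmorphM, rmorphD) /= !ratderivE ?mulf_neq0 //.
rewrite addf_div ?tofrac_eq0 ?expf_neq0 // -!(rmorphM, rmorphD) /=.
apply/eqP; rewrite eq_fraction ?(mulf_neq0, expf_neq0) // !(derivD, derivM).
by apply/eqP; ring.
Qed.

Lemma ratderivM r s : ratderiv (r * s) = ratderiv r * s + r * ratderiv s.
Proof.
elim/fraction_ind: r => a b b0; elim/fraction_ind: s => c d d0.
rewrite mulf_div -!rmorphM /= !ratderivE ?mulf_neq0 //.
rewrite !mulf_div -!rmorphM /= addf_div ?tofrac_eq0 ?(mulf_neq0, expf_neq0) //.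
rewrite -!(rmorphM, rmorphD) /=.
apply/eqP; rewrite eq_fraction ?(mulf_neq0, expf_neq0) // !(derivD, derivM).
by apply/eqP; ring.
Qed.
End RatDerivTheory.

Section QuadraticAlgebra.
Variable K : comPzRingType.
Implicit Types (r s p q y P k : K).

Lemma qe_sub r s p q y : r + s * y - (p + q * y) = (r - p) + (s - q) * y.
Proof. by ring. Qed.

Lemma qe_mul r s p q y P : y ^+ 2 = P ->
  (r + s * y) * (p + q * y) = (r * p + s * q * P) + (r * q + s * p) * y.
Proof. by move=> <-; ring. Qed.

Lemma qe_add r s p q y k l :
  r + p + (s + q + (k + l)) * y = r + (s + k) * y + (p + (q + l) * y).
Proof. by ring. Qed.

Lemma qe_leibniz r s p q y k r' s' p' q' :
  r' * p + r * p' +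
    (s' * q * y ^+ 2 + s * q' * y ^+ 2 + s * q * (2%:R * k * y ^+ 2)) +
    (r' * q * y + r * q' * y + (s' * p * y + s * p' * y) +
      (r * q * k * y + s * p * k * y)) =
  r' * (p + q * y) + (s' * y * (p + q * y) + s * k * y * (p + q * y)) +
    (r * (p' + (q' * y + q * k * y)) + s * y * (p' + (q' * y + q * k * y))).
Proof. by ring. Qed.
End QuadraticAlgebra.

Section FunctionField.
Variable F : numClosedFieldType.

(* The smooth projective model of y^2 = rhs(x), where rhs is separable of
   degree 2 genus + 1 or 2 genus + 2. *)
Record hyperelliptic := Hyperelliptic {
  genus : nat;
  rhs : {poly F};
  size_rhs : ((2 * genus).+2 <= size rhs <= (2 * genus).+3)%N;
  separable_rhs : separable_poly rhs }.

(* A field generated over F(x) by a square root y of P. *)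
Record function_field (P : {poly F}) := FunctionField {
  ff_carrier : fieldType;
  ff_ratfun : {rmorphism {fraction {poly F}} -> ff_carrier};
  ff_y : ff_carrier;
  ff_y_sqr : ff_y ^+ 2 = ff_ratfun P%:F;
  ff_span : forall g, exists r s, g = ff_ratfun r + ff_ratfun s * ff_y }.

Implicit Types X : hyperelliptic.

Lemma rhs_neq0 X : rhs X != 0.
Proof. exact/separable_poly_neq0/separable_rhs. Qed.

Lemma rhs_nonsquare X (n d : {poly F}) : d != 0 -> n ^+ 2 != rhs X * d ^+ 2.
Proof.
move=> d0; apply/eqP=> e.
have /andP[s1 _] := size_rhs X.
have [a ra] : exists a, root (rhs X) a.
  by apply/closed_rootP; rewrite neq_ltn (leq_trans _ s1) ?orbT.
have r0 := rhs_neq0 X.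
have n0 : n != 0.
  apply: contra_eq_neq e => ->; rewrite expr0n /= eq_sym.
  by rewrite mulf_neq0 ?expf_neq0.
have := congr1 (mup a) e; rewrite !expr2 !mupM ?mulf_neq0 //.
suff -> : mup a (rhs X) = 1%N by lia.
apply/eqP; rewrite eqn_leq mup_leq // mup_geq // expr1 dvdp_XsubCl ra andbT.
apply/negP => /dvdpP[q eq].
have := separable_rhs X; rewrite unlock => /coprimep_root /(_ ra).
by rewrite eq expr2 mulrA derivM derivXsubC !hornerE subrr !(mulr0, addr0) eqxx.
Qed.

Lemma ratfun_nonsquare X (r : {fraction {poly F}}) : r ^+ 2 != (rhs X)%:F.
Proof.
elim/fraction_ind: r => n d d0; apply/eqP.
rewrite expr_div_n -!rmorphXn /= => /(canRL (divfK _)).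
rewrite tofrac_eq0 expf_neq0 // => /(_ isT).
by rewrite -rmorphM => /eqP; rewrite tofrac_eq; apply/negP/rhs_nonsquare.
Qed.

Fact function_field_exists X : function_field (rhs X).
Proof.
pose h : {poly {fraction {poly F}}} := 'X^2 - ((rhs X)%:F)%:P.
have sh : size h = 3%N.
  by rewrite size_polyDl size_polyXn // size_polyN size_polyC; case: eqP.
have mh : h \is monic.
  rewrite monicE lead_coefDl ?lead_coefXn // size_polyXn size_polyN size_polyC.
  by case: eqP.
have hI : monic_irreducible_poly h.
  split => //; apply: cubic_irreducible; rewrite ?sh // => r.
  rewrite /root !hornerE subr_eq0; exact: ratfun_nonsquare.
have mkh : mk_monic h = h by exact: (mk_monicE hI).
pose K : fieldType := {poly %/ h with hI}.
pose f : {fraction {poly F}} -> K := qpolyC h.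
have fB : zmod_morphism f by move=> a b; rewrite /f qpolyCD qpolyCN.
have fM : monoid_morphism f by split => // a b; rewrite /f qpolyCM.
pose f1 := GRing.isZmodMorphism.Build _ _ f fB.
pose f2 := GRing.isMonoidMorphism.Build _ _ f fM.
pose fR : {rmorphism {fraction {poly F}} -> K} := HB.pack f f1 f2.
apply: (@FunctionField _ K fR (in_qpoly h 'X)).
  rewrite -rmorphXn /=; apply/val_inj => /=; rewrite mkh.
  have -> : 'X^2 = 1 * h + ((rhs X)%:F)%:P by rewrite mul1r subrK.
  rewrite Pdiv.RingMonic.rmodp_addl_mul_small // sh size_polyC.
  by case: eqP.
move=> g; exists (g : {poly _})`_0, (g : {poly _})`_1.
have inC c : fR c = in_qpoly h c%:P.
  by apply: val_inj; rewrite /= Pdiv.CommonRing.rmodp_small // mkh sh size_polyC; case: eqP.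
have sg : (size (g : {poly _}) <= 2)%N.
  have H : (size (mk_monic h) <= 3)%N by rewrite mkh sh.
  by rewrite -ltnS; apply: leq_trans H; exact: size_mk_monic.
rewrite !inC -rmorphM -rmorphD /=; apply: val_inj; rewrite /= Pdiv.CommonRing.rmodp_small.
  apply/polyP => i; rewrite coefD coefC coefCM coefX.
  case: i => [|[|i]] /=; rewrite ?(mulr0, mulr1, addr0, add0r) //.
  by rewrite nth_default // (leq_trans sg).
have H : (2 < size (mk_monic h))%N by rewrite mkh sh.
apply: leq_trans H; rewrite (leq_ltn_trans (size_polyD _ _)) // gtn_max size_polyC.
rewrite (leq_ltn_trans (leq_b1 _)) //= ltnS.
by rewrite (leq_trans (size_polyMleq _ _)) // size_polyX size_polyC; case: eqP.
Qed.

(* The function field of X is characterised up to isomorphism by the fields of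
   the record; its construction above is opaque on purpose. *)
Definition model X : function_field (rhs X) := function_field_exists X.
Definition funfield X : fieldType := ff_carrier (model X).
Definition ratfun X : {rmorphism {fraction {poly F}} -> funfield X} :=
  ff_ratfun (model X).
Definition constf X (c : F) : funfield X := ratfun X (c%:P)%:F.
Definition coordx X : funfield X := ratfun X ('X)%:F.
Definition coordy X : funfield X := ff_y (model X).

HB.instance Definition _ X := GRing.RMorphism.copy (constf X)
  (ratfun X \o @FracField.tofrac _ \o polyC).

Lemma funfield_coords_uniq X (r s r' s' : {fraction {poly F}}) :
  ratfun X r + ratfun X s * coordy X = ratfun X r' + ratfun X s' * coordy X ->
  r = r' /\ s = s'.
Proof.
move=> e; have {e} e : ratfun X (r - r') = ratfun X (s' - s) * coordy X.
  rewrite !rmorphB /=; move: e.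
  set A := ratfun X r; set B := ratfun X r'; set C := ratfun X s.
  set D := ratfun X s' => e.
  by apply/eqP; rewrite mulrBl subr_eq addrAC [D * _ + B]addrC -e addrK.
have [s0|s0] := eqVneq (s' - s) 0.
  move: e; rewrite s0 rmorph0 mul0r => /eqP; rewrite fmorph_eq0 subr_eq0 => /eqP->.
  by move/eqP: s0; rewrite subr_eq0 => /eqP->.
have y2 : coordy X ^+ 2 = ratfun X (rhs X)%:F by exact: ff_y_sqr.
have : ratfun X ((r - r') / (s' - s)) ^+ 2 == ratfun X (rhs X)%:F.
  by rewrite -y2 fmorph_div /= e mulrC mulKf ?fmorph_eq0.
rewrite -rmorphXn /= fmorph_eq => H.
by have := ratfun_nonsquare X ((r - r') / (s' - s)); rewrite H.
Qed.

Lemma funfield_coords X : exists c : funfield X -> {fraction {poly F}} * {fraction {poly F}},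
  forall r s, c (ratfun X r + ratfun X s * coordy X) = (r, s).
Proof.
have /choice[c cE] : forall g : funfield X, exists rs : _ * _,
    g = ratfun X rs.1 + ratfun X rs.2 * coordy X.
  by move=> g; have [r [s e]] := ff_span g; exists (r, s).
exists c => r s; have := cE (ratfun X r + ratfun X s * coordy X).
by case: (c _) => r' s' /= /funfield_coords_uniq [-> ->].
Qed.

(* The derivation d/dx of the function field over the constants. *)
Record dx_derivation X := DxDerivation {
  dx_fun :> funfield X -> funfield X;
  dx_funD : forall g h, dx_fun (g + h) = dx_fun g + dx_fun h;
  dx_funM : forall g h, dx_fun (g * h) = dx_fun g * h + g * dx_fun h;
  dx_fun_const : forall c, dx_fun (constf X c) = 0;
  dx_fun_x : dx_fun (coordx X) = 1 }.

Fact dx_derivation_exists X : dx_derivation X.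
Proof.
have /cid[c cE] := funfield_coords X.
pose k := (rhs X)^`()%:F / (2%:R * (rhs X)%:F).
pose d g := ratfun X (ratderiv (c g).1) +
  (ratfun X (ratderiv (c g).2) + ratfun X ((c g).2 * k)) * coordy X.
have dE r s : d (ratfun X r + ratfun X s * coordy X) = 
  ratfun X (ratderiv r) + (ratfun X (ratderiv s) + ratfun X (s * k)) * coordy X.
  by rewrite /d cE.
have yE : coordy X ^+ 2 = ratfun X (rhs X)%:F by exact: ff_y_sqr.
have kE : 2%:R * ratfun X k * ratfun X (rhs X)%:F = ratfun X (ratderiv (rhs X)%:F).
  have two0 : 2%:R != 0 :> {fraction {poly F}}.
    by rewrite -(rmorph_nat (@FracField.tofrac {poly F})) tofrac_eq0 -polyC_natr polyC_eq0 pnatr_eq0.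
  have P0 : (rhs X)%:F != 0 by rewrite tofrac_eq0 rhs_neq0.
  rewrite -(rmorph_nat (ratfun X)) -!rmorphM /= ratderiv_tofrac /k; congr (ratfun X _).
  exact (half_quotient _ two0 P0).
have dr r : d (ratfun X r) = ratfun X (ratderiv r).
  rewrite -[ratfun X r]addr0 -(mul0r (coordy X)) -(rmorph0 (ratfun X)) dE.
  by rewrite mul0r -tofrac0 ratderiv_tofrac derivC !rmorph0 addr0 mul0r addr0.
clearbody d k; exists d.
- move=> g h; have [r [s ->]] := ff_span g; have [p [q ->]] := ff_span h.
  rewrite -/(funfield X) -/(ratfun X) -/(coordy X).
  rewrite addrACA -mulrDl -!rmorphD !dE !ratderivD [(s + q) * k]mulrDl !rmorphD.
  exact: qe_add.
- move=> g h; have [r [s ->]] := ff_span g; have [p [q ->]] := ff_span h.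
  rewrite -/(funfield X) -/(ratfun X) -/(coordy X).
  rewrite (qe_mul _ _ _ _ yE) -!(rmorphM, rmorphD) /= !dE.
  rewrite !(ratderivD, ratderivM, mulrDl, rmorphD, rmorphM). rewrite -kE -yE.
  exact: qe_leibniz.
- by move=> a; rewrite dr ratderiv_tofrac derivC !rmorph0.
- by rewrite dr ratderiv_tofrac derivX !rmorph1.
Qed.

Definition ddx X : dx_derivation X := dx_derivation_exists X.

Lemma derivation_eq0 X (M : lmodType (funfield X)) (D : funfield X -> M) :
  (forall g h, D (g + h) = D g + D h) ->
  (forall g h, D (g * h) = h *: D g + g *: D h) ->
  (forall c, D (constf X c) = 0) -> D (coordx X) = 0 -> forall g, D g = 0.
Proof.
move=> DD DM Dc Dx.
have Dp p : D (ratfun X p%:F) = 0.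
  elim/poly_ind: p => [|p c IH].
    by rewrite -polyC0; exact: Dc.
  rewrite !(rmorphD, rmorphM) DD DM IH.
  by rewrite [D (ratfun X _)]Dx [D (ratfun X _)]Dc !scaler0 !addr0.
have Dr r : D (ratfun X r) = 0.
  elim/fraction_ind: r => a b b0.
  have b0' : ratfun X b%:F != 0 by rewrite fmorph_eq0 tofrac_eq0.
  have bF : b%:F != 0 by rewrite tofrac_eq0.
  have := Dp a; rewrite -[in X in X -> _](divfK bF a%:F) rmorphM DM Dp.
  rewrite scaler0 addr0 => /eqP; rewrite scaler_eq0 (negPf b0') /=.
  by move/eqP.
have yE : coordy X ^+ 2 = ratfun X (rhs X)%:F by exact: ff_y_sqr.
have Dy : D (coordy X) = 0.
  have := Dr (rhs X)%:F; rewrite -yE expr2 DM -scalerDl => /eqP.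
  rewrite scaler_eq0 -mulr2n -mulr_natr mulf_eq0.
  rewrite -(rmorph_nat (constf X)) fmorph_eq0 pnatr_eq0 orbF.
  case/orP => [/eqP y0|/eqP//]; rewrite y0.
  by have := Dc 0; rewrite rmorph0.
move=> g; have [r [s ->]] := ff_span g.
by rewrite DD DM Dr Dr [D (ff_y _)]Dy !scaler0 !addr0.
Qed.

Section Lift.
Variables (X : hyperelliptic) (L : fieldType) (phi : {rmorphism {poly F} -> L}).
Variable w : L.
Hypotheses (phi_inj : injective phi) (w2 : w ^+ 2 = phi (rhs X)).

Lemma funfield_lift : exists f : {rmorphism funfield X -> L},
  (forall p : {poly F}, f (ratfun X p%:F) = phi p) /\ f (coordy X) = w.
Proof.
have /cid[c cE] := funfield_coords X.
pose psi := fraction_lift phi.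
pose psi1 := GRing.isZmodMorphism.Build _ _ psi (fraction_lift_additive phi_inj).
pose psi2 := GRing.isMonoidMorphism.Build _ _ psi (fraction_lift_multiplicative phi_inj).
pose Psi : {rmorphism {fraction {poly F}} -> L} := HB.pack psi psi1 psi2.
have PsiE p : Psi p%:F = phi p.
  have := fraction_liftE phi_inj p (oner_neq0 _).
  by rewrite tofrac1 rmorph1 !divr1.
pose f g := Psi (c g).1 + Psi (c g).2 * w.
have fE r s : f (ratfun X r + ratfun X s * coordy X) = Psi r + Psi s * w.
  by rewrite /f cE.
have yE : coordy X ^+ 2 = ratfun X (rhs X)%:F by exact: ff_y_sqr.
have fr r : f (ratfun X r) = Psi r.
  rewrite -[ratfun X r]addr0 -(mul0r (coordy X)) -(rmorph0 (ratfun X)) fE.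
  by rewrite rmorph0 mul0r addr0.
have fB : zmod_morphism f.
  move=> g h; have [r [s ->]] := ff_span g; have [p [q ->]] := ff_span h.
  rewrite -/(funfield X) -/(ratfun X) -/(coordy X).
  rewrite qe_sub -!rmorphB !fE !rmorphB; exact/esym/qe_sub.
have fM : monoid_morphism f.
  split; first by rewrite -(rmorph1 (ratfun X)) fr rmorph1.
  move=> g h; have [r [s ->]] := ff_span g; have [p [q ->]] := ff_span h.
  rewrite -/(funfield X) -/(ratfun X) -/(coordy X).
  rewrite (qe_mul _ _ _ _ yE) -!(rmorphM, rmorphD) /= !fE.
  have w2' : w ^+ 2 = Psi (rhs X)%:F by rewrite PsiE.
  by rewrite (qe_mul _ _ _ _ w2') -!(rmorphM, rmorphD).
pose f1 := GRing.isZmodMorphism.Build _ _ f fB.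
pose f2 := GRing.isMonoidMorphism.Build _ _ f fM.
pose fR : {rmorphism funfield X -> L} := HB.pack f f1 f2.
exists fR; split; first by move=> p; rewrite /= fr PsiE.
have := fE 0 1; rewrite !rmorph0 !rmorph1 !add0r !mul1r; exact.
Qed.
End Lift.
End FunctionField.

Notation "c %:K" := (constf _ c) (at level 2, format "c %:K") : ring_scope.
Arguments coordx {F X}.
Arguments coordy {F X}.

Section Curve.
Variables (F : numClosedFieldType) (X : hyperelliptic F).
Local Notation K := (funfield X).

(* X is glued from the affine curves v^2 = rhs(u) and w^2 = s^(2g+2) rhs(1/s)
   along s = 1/u, w = v/u^(g+1); the points of the second one that are missing
   from the first one have s = 0. *)
Variant curve_point :=
  | AffinePoint (a b : F) of b ^+ 2 == (rhs X).[a]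
  | InfinitePoint (w : F) of w ^+ 2 == (rhs X)`_(2 * genus X).+2.

Definition chart (p : curve_point) : K * K :=
  match p with
  | AffinePoint _ _ _ => (coordx, coordy)
  | InfinitePoint _ _ => (coordx^-1, coordy / coordx ^+ (genus X).+1)
  end.

Definition chart_value (p : curve_point) : F * F :=
  match p with
  | AffinePoint a b _ => (a, b)
  | InfinitePoint w _ => (0, w)
  end.

(* A polynomial N(u, v), with v the outer variable, as a function on the affine
   chart containing p; chart_poly_value is its value at p. *)
Definition chart_poly (p : curve_point) (N : {poly {poly F}}) : K :=
  (map_poly (map_poly (constf X)) N).[(chart p).2, (chart p).1].

Definition chart_poly_value (p : curve_point) (N : {poly {poly F}}) : F :=
  N.[(chart_value p).2, (chart_value p).1].

Definition local_ring (p : curve_point) : set K := [set g |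
  exists N D : {poly {poly F}},
    chart_poly_value p D != 0 /\ g * chart_poly p D = chart_poly p N].

Definition maximal_ideal (p : curve_point) : set K := [set g |
  exists N D : {poly {poly F}},
    [/\ chart_poly_value p D != 0, chart_poly_value p N = 0
      & g * chart_poly p D = chart_poly p N]].

Definition uniformizer (p : curve_point) : set K := [set z |
  maximal_ideal p z /\
  forall g, maximal_ideal p g -> exists2 h, local_ring p h & g = h * z].

Definition ord_ge (p : curve_point) (n : int) : set K := [set g |
  exists z h, [/\ uniformizer p z, local_ring p h & g = h * z ^ n]].

(* Rational 1-forms: the form h dx is represented by h.  This is the module of
   Kaehler differentials of K over F, see diff_universal. *)
Definition Omega : lmodType K := K^o.
Definition diff (g : K) : Omega := ddx X g.

Lemma diff_universal (M : lmodType K) (D : K -> M) :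
  (forall g h, D (g + h) = D g + D h) ->
  (forall g h, D (g * h) = h *: D g + g *: D h) ->
  (forall c, D c%:K = 0) ->
  forall g, D g = (diff g : K) *: D coordx.
Proof.
move=> DD DM Dc g; apply/eqP; rewrite -subr_eq0; apply/eqP; move: g.
apply: (@derivation_eq0 _ X M (fun g => D g - (diff g : K) *: D coordx)).
- by move=> g h; rewrite DD /diff dx_funD scalerDl opprD addrACA.
- move=> g h; rewrite DM /diff dx_funM scalerDl opprD addrACA !scalerBr !scalerA.
  by rewrite [h * _]mulrC.
- by move=> c; rewrite Dc /diff dx_fun_const scale0r subr0.
- by rewrite /diff dx_fun_x scale1r subrr.
Qed.

(* Omega_{X,p} is generated by dz over the local ring, z a uniformizer. *)
Definition form_ord_ge (p : curve_point) (n : int) : set Omega := [set eta |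
  exists z h, [/\ uniformizer p z, local_ring p h & eta = (h * z ^ n) *: diff z]].

(* eta has at most a simple pole at p, with residue r. *)
Definition residue_at (p : curve_point) (eta : Omega) (r : F) : Prop :=
  exists z h, [/\ uniformizer p z, local_ring p h
                & eta = (r%:K / z + h) *: diff z].

(* The nonempty Zariski open sets. *)
Definition cofinite (U : set curve_point) : Prop := finite_set (~` U).

Definition divisor := curve_point -> int.
Definition point_divisor (q : curve_point) : divisor :=
  fun p => if `[< p = q >] then 1 else 0.

Section Sheaves.
Variables (W : lmodType K).
(* A subsheaf of the constant sheaf W, given by its sections over nonempty open
   sets. *)
Definition subsheaf := set curve_point -> set W.

(* e is a basis of the O_X-module E over the open set V. *)
Definition local_frame (n : nat) (E : subsheaf) (V : set curve_point) (e : n.-tuple W) :=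
  (forall a : 'I_n -> K, \sum_(i < n) a i *: tnth e i = 0 -> forall i, a i = 0) /\
  (forall U, cofinite U -> U `<=` V -> E U = [set w |
     exists2 a : 'I_n -> K, (forall i p, U p -> local_ring p (a i))
                          & w = \sum_(i < n) a i *: tnth e i]).

Definition vector_bundle (n : nat) (E : subsheaf) :=
  forall p, exists V (e : n.-tuple W), [/\ cofinite V, V p & local_frame E V e].

Definition generic_basis (n : nat) (e : n.-tuple W) :=
  forall w, exists! a : {ffun 'I_n -> K}, w = \sum_(i < n) a i *: tnth e i.

(* WO plays the role of the tensor product of W and Omega over K, with
   canonical map tens; nabla is the action of a meromorphic connection on
   rational sections.  It is C-linear because d vanishes on constants. *)
Variables (WO : lmodType K) (tens : W -> Omega -> WO) (nabla : W -> WO).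

Definition is_connection :=
  (forall v w, nabla (v + w) = nabla v + nabla w) /\
  (forall g w, nabla (g *: w) = tens w (diff g) + g *: nabla w).

(* nabla e_j = \sum_i A_ij e_i. *)
Definition connection_matrix (n : nat) (e : n.-tuple W) (A : 'M[Omega]_n) :=
  forall j, nabla (tnth e j) = \sum_(i < n) tens (tnth e i) (A i j).

(* In every local frame of E at p, the entries of the matrix of nabla have order
   at least k at p. *)
Definition connection_ord_ge (n : nat) (E : subsheaf) (p : curve_point) (k : int) :=
  forall V (e : n.-tuple W), cofinite V -> V p -> local_frame E V e ->
  exists2 A : 'M[Omega]_n, connection_matrix e A
                         & forall i j, form_ord_ge p k (A i j).
Definition regular_connection_at n E p := @connection_ord_ge n E p 0.
Definition logarithmic_connection n E := forall p, @connection_ord_ge n E p (- 1).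
End Sheaves.

Definition scalar_tens (g : K^o) (eta : Omega) : Omega := (g : K) *: eta.

(* The connection d + omega on (the rational sections of) a line bundle. *)
Definition line_connection (omega : Omega) (g : K^o) : Omega :=
  diff g + scalar_tens g omega.

(* O_X(D). *)
Definition line_bundle (D : divisor) : subsheaf K^o := fun U => [set g |
  forall p, U p -> ord_ge p (- D p) g].
End Curve.
Arguments scalar_tens {F X}.

(* An L-module seen as a K-module through f : K -> L. *)
Section RestrictScalars.
Definition restr (K L : fieldType) (f : {rmorphism K -> L}) (W : Type) : Type := W.
Variables (K L : fieldType) (f : {rmorphism K -> L}) (W : lmodType L).
HB.instance Definition _ := GRing.Zmodule.on (restr f W).
Definition restr_scale (a : K) (w : restr f W) : restr f W := f a *: (w : W).
Fact restr_scaleA a b w : restr_scale a (restr_scale b w) = restr_scale (a * b) w.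
Proof. by rewrite /restr_scale scalerA rmorphM. Qed.
Fact restr_scale1 : left_id 1 restr_scale.
Proof. by move=> w; rewrite /restr_scale rmorph1 scale1r. Qed.
Fact restr_scaleDr : right_distributive restr_scale +%R.
Proof. by move=> a v w; rewrite /restr_scale scalerDr. Qed.
Fact restr_scaleDl w : {morph restr_scale^~ w : a b / a + b}.
Proof. by move=> a b; rewrite /restr_scale rmorphD scalerDl. Qed.
HB.instance Definition _ := GRing.Zmodule_isLmodule.Build K (restr f W)
  restr_scaleA restr_scale1 restr_scaleDr restr_scaleDl.
End RestrictScalars.

(* Direct images along a morphism Y -> X given by its effect f on points and
   fs = f^* on rational functions.  At the generic point of X,
   f_* (W (x) Omega_Y) = (f_* W) (x) Omega_X by means of f^* on forms; under
   this identification the direct image of a connection is the same map. *)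
Section DirectImage.
Variables (F : numClosedFieldType) (X Y : hyperelliptic F).
Variables (f : curve_point Y -> curve_point X) (fs : {rmorphism funfield X -> funfield Y}).

Definition pullback_form (eta : Omega X) : Omega Y :=
  fs (eta : funfield X) *: diff (fs coordx).

Variables (W WO : lmodType (funfield Y)).

Definition direct_image (E : subsheaf W) : subsheaf (restr fs W) :=
  fun V => E (f @^-1` V).

Definition direct_image_tens (tens : W -> Omega Y -> WO) :
    restr fs W -> Omega X -> restr fs WO :=
  fun w eta => tens w (pullback_form eta).

Definition direct_image_connection (nabla : W -> WO) :
    restr fs W -> restr fs WO := nabla.
End DirectImage.
Arguments direct_image {F X Y} f fs {W} E.
Arguments direct_image_tens {F X Y} fs {W WO} tens.
Arguments direct_image_connection {F X Y} fs {W WO} nabla.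

Section Bielliptic.
Variables (F : numClosedFieldType) (t t' : F).

Definition bielliptic_parameters :=
  [&& t != 0, t != 1, t' != 0, t' != 1 & t != t'].

Definition elliptic_rhs : {poly F} := 'X * ('X - 1) * ('X - t%:P).
Definition genus2_rhs : {poly F} :=
  (t'%:P - 'X^2) * ((t' - 1)%:P - 'X^2) * ((t' - t)%:P - 'X^2).

Hypothesis ht : bielliptic_parameters.

Fact size_elliptic_rhs : ((2 * 1).+2 <= size elliptic_rhs <= (2 * 1).+3)%N.
Proof.
have -> : elliptic_rhs = \prod_(a <- [:: 0; 1; t]) ('X - a%:P).
  by rewrite !big_cons big_nil subr0 mulr1 mulrA.
by rewrite size_prod_XsubC.
Qed.

Fact separable_elliptic_rhs : separable_poly elliptic_rhs.
Proof.
have -> : elliptic_rhs = \prod_(a <- [:: 0; 1; t]) ('X - a%:P).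
  by rewrite !big_cons big_nil subr0 mulr1 mulrA.
have /and5P[t0 t1 _ _ _] := ht.
rewrite separable_prod_XsubC /= !inE !negb_or /= eq_sym oner_eq0 eq_sym t0 /=.
by rewrite eq_sym t1.
Qed.

Definition elliptic_curve : hyperelliptic F :=
  Hyperelliptic size_elliptic_rhs separable_elliptic_rhs.

Lemma size_csubX2 (a : F) : size (a%:P - 'X^2) = 3%N.
Proof.
rewrite -opprB size_polyN size_polyDl size_polyXn // size_polyN size_polyC.
by case: eqP.
Qed.

Lemma lead_csubX2 (a : F) : lead_coef (a%:P - 'X^2) = -1.
Proof.
rewrite -opprB lead_coefN lead_coefDl ?lead_coefXn //.
by rewrite size_polyXn size_polyN size_polyC; case: eqP.
Qed.

Lemma csubX2_neq0 (a : F) : a%:P - 'X^2 != 0.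
Proof. by rewrite -size_poly_gt0 size_csubX2. Qed.

Lemma size_genus2_rhs_eq : size genus2_rhs = 7%N.
Proof. by rewrite !size_mul ?mulf_neq0 ?csubX2_neq0 // !size_csubX2. Qed.

Fact size_genus2_rhs : ((2 * 2).+2 <= size genus2_rhs <= (2 * 2).+3)%N.
Proof. by rewrite size_genus2_rhs_eq. Qed.

Fact separable_genus2_rhs : separable_poly genus2_rhs.
Proof.
have /and5P[t0 t1 t0' t1' tt'] := ht.
have sep (a : F) : a != 0 -> separable_poly (a%:P - 'X^2).
  move=> a0; rewrite unlock; apply/Bezout_eq1_coprimepP.
  have e : (a^-1)%:P * a%:P = 1 :> {poly F} by rewrite -polyCM mulVf.
  have e2 : ((2%:R * a)^-1)%:P * 2%:R = (a^-1)%:P :> {poly F}.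
    by rewrite -polyC_natr -polyCM invfM mulrAC mulVf ?mul1r // pnatr_eq0.
  exists ((a^-1)%:P, - (((2%:R * a)^-1)%:P * 'X)) => /=.
  rewrite derivB derivC derivXn sub0r /= expr1 mulrBr e.
  by rewrite -e2; ring.
have cop (a b : F) : a != b -> coprimep (a%:P - 'X^2) (b%:P - 'X^2).
  move=> ab; apply/Bezout_eq1_coprimepP.
  exists (((a - b)^-1)%:P, - ((a - b)^-1)%:P) => /=.
  rewrite mulNr -mulrBr opprB addrA subrK -polyCB -polyCM mulVf ?subr_eq0 //.
have t'N1 : t' != t' - 1 by rewrite eq_sym -subr_eq0 addrAC subrr sub0r oppr_eq0 oner_eq0.
have t'Nt : t' != t' - t by rewrite eq_sym -subr_eq0 addrAC subrr sub0r oppr_eq0.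
have t1Nt : t' - 1 != t' - t by rewrite (inj_eq (addrI _)) eqr_opp eq_sym.
rewrite /genus2_rhs !separable_mul !sep ?subr_eq0 // 1?eq_sym //=.
by rewrite coprimepMl !cop // eq_sym.
Qed.

Definition genus2_curve : hyperelliptic F :=
  Hyperelliptic size_genus2_rhs separable_genus2_rhs.

Fact genus2_rhs_coef6 : (rhs genus2_curve)`_6 = -1.
Proof.
have -> : (rhs genus2_curve)`_6 = lead_coef genus2_rhs.
  by rewrite lead_coefE size_genus2_rhs_eq.
by rewrite !lead_coefM !lead_csubX2 mulrNN mul1r mul1r.
Qed.

Fact elliptic_rhs_coef4 : (rhs elliptic_curve)`_4 = 0.
Proof.
rewrite nth_default //=.
have -> : elliptic_rhs = \prod_(a <- [:: 0; 1; t]) ('X - a%:P).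
  by rewrite !big_cons big_nil subr0 mulr1 mulrA.
by rewrite size_prod_XsubC.
Qed.

Local Notation E := elliptic_curve.
Local Notation C := genus2_curve.

Fact elliptic_on_curve (a b : F) :
  b ^+ 2 = a * (a - 1) * (a - t) -> b ^+ 2 == (rhs E).[a].
Proof. by move=> ->; rewrite /= /elliptic_rhs !hornerE. Qed.

Fact genus2_on_curve (a b : F) :
  b ^+ 2 = (t' - a ^+ 2) * (t' - 1 - a ^+ 2) * (t' - t - a ^+ 2) ->
  b ^+ 2 == (rhs C).[a].
Proof. by move=> ->; rewrite /= /genus2_rhs !hornerE. Qed.

Definition elliptic_point a b hab : curve_point E :=
  AffinePoint (@elliptic_on_curve a b hab).
Definition genus2_point a b hab : curve_point C :=
  AffinePoint (@genus2_on_curve a b hab).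

Fact elliptic_infinity_proof : 0 ^+ 2 == (rhs E)`_(2 * genus E).+2.
Proof. by rewrite expr0n elliptic_rhs_coef4. Qed.
Definition elliptic_infinity : curve_point E := InfinitePoint elliptic_infinity_proof.

Fact genus2_infinity_proof (s : bool) :
  ((-1) ^+ s * 'i) ^+ 2 == (rhs C)`_(2 * genus C).+2.
Proof. by rewrite exprMn sqrCi sqrr_sign mul1r genus2_rhs_coef6. Qed.
(* infty_+ and infty_-, the points where y / xi^3 = +i and -i. *)
Definition genus2_infinity (s : bool) : curve_point C :=
  InfinitePoint (genus2_infinity_proof s).

Fact branch_point_proof (y0 : F) (s : bool) :
  y0 ^+ 2 = t' * (t' - 1) * (t' - t) ->
  ((-1) ^+ s * y0) ^+ 2 = t' * (t' - 1) * (t' - t).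
Proof. by rewrite exprMn sqrr_sign mul1r. Qed.
(* p_+ for s = false and p_- for s = true. *)
Definition branch_point y0 hy0 (s : bool) : curve_point E :=
  elliptic_point (@branch_point_proof y0 s hy0).

Fact bielliptic_map_proof (a b : F) : b ^+ 2 == (rhs C).[a] ->
  b ^+ 2 == (rhs E).[t' - a ^+ 2].
Proof.
move/eqP->; apply/eqP; rewrite /= /genus2_rhs /elliptic_rhs !hornerE.
by congr (_ * _ * _); ring.
Qed.

Definition bielliptic_map (p : curve_point C) : curve_point E :=
  match p with
  | AffinePoint a b hab => AffinePoint (bielliptic_map_proof hab)
  | InfinitePoint _ _ => elliptic_infinity
  end.

(* The morphism (xi, y) |-> (t' - xi^2, y) on functions; these values determine
   it. *)
Fact bielliptic_pullback_exists :
  {fs : {rmorphism funfield E -> funfield C} |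
    [/\ forall c, fs c%:K = c%:K, fs coordx = t'%:K - coordx ^+ 2
      & fs coordy = coordy]}.
Proof.
apply: cid.
pose q : {poly F} := t'%:P - 'X^2.
pose phi : {rmorphism {poly F} -> funfield C} :=
  ratfun C \o @FracField.tofrac _ \o comp_poly q.
have phi_inj : injective phi.
  move=> a b /fmorph_inj /eqP; rewrite tofrac_eq -subr_eq0 => /eqP.
  rewrite -raddfB /= => /eqP; rewrite comp_poly_eq0 ?size_csubX2 //.
  by rewrite subr_eq0 => /eqP.
have w2 : coordy ^+ 2 = phi (rhs E).
  rewrite [LHS](ff_y_sqr (model C)) /=; congr (ratfun C _%:F).
  rewrite /elliptic_rhs /genus2_rhs /q !comp_polyM !comp_polyB !comp_polyX.
  by rewrite -polyC1 !comp_polyC !polyCB; congr (_ * _ * _); ring.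
have [fs [fsP fsy]] := funfield_lift phi_inj w2.
exists fs; split => //.
- by move=> c; rewrite fsP /= comp_polyC.
- by rewrite fsP /= comp_polyX !rmorphB /= -rmorphXn /= -rmorphXn.
Qed.

Definition bielliptic_pullback : {rmorphism funfield E -> funfield C} :=
  sval bielliptic_pullback_exists.
End Bielliptic.
Arguments bielliptic_map {F t t'} ht p.

Definition mx2 (V : nmodType) (a b c d : V) : 'M[V]_2 :=
  \matrix_(i < 2, j < 2) tnth (tnth [tuple [tuple a; b]; [tuple c; d]] i) j.

(* Main.v *)
(* At every point of a hyperelliptic curve the local ring is a discrete valuation
   ring: [N(u, v)] divides its norm, a nonzero polynomial in [u].  Let [deck] be
   the involution xi |-> -xi of [C] over [E].  If [theta] is anti-invariant then
   [g = (g + deck g) / 2 + (g - deck g) / (2 theta) * theta], and both coefficients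
   come from [E]; hence, if [theta] is a unit on an unramified fibre and [u]
   generates O(D) along it, then [(u, u theta)] is a basis of the stalk of the
   direct image.  With [nabla u = u k dz], [z] a uniformizer pulled back from [E],
   [k] is regular along the fibre and so decomposes on [(1, theta)] with regular
   coefficients: the direct image is regular there.  At a ramification point
   [(1, xi)] itself is a basis of the stalk, because [xi^2] is a uniformizer of [E]
   up to sign, and the explicit matrix has a simple pole with lower right residue
   1/2.  Two local frames differ by an invertible matrix of regular functions, so
   one frame at each point decides. *)
From HB Require Import structures.
Require Import Defs.
From mathcomp Require Import all_boot all_order all_algebra all_field.
From mathcomp Require Import complex ring zify.
From mathcomp Require Import all_classical all_reals.

Set Implicit Arguments.
Unset Strict Implicit.
Unset Printing Implicit Defensive.

Import Order.TTheory GRing.Theory Num.Theory.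

Local Open Scope ring_scope.
Local Open Scope classical_set_scope.

(** * Charts and their coordinates *)

(** The function field is known only through its generators and their relation, and a local ring
    only as fractions of chart polynomials, so evaluation at a point must first be shown to be well
    defined. It is: (1, v) is free over the polynomials in u, hence a polynomial that is zero as a
    function is a multiple of v^2 - R(u) and vanishes at the point. Local arguments then run through
    the relation [value_at]. An unramified fibre has two points, and a generator of O(D) at one of
    them must also generate at the other; this calls for a function vanishing simply at one point
    and not at the other. The odd function xi has poles at infinity, where y / xi^3 replaces it.
    Descent to E rests on the valuation ring property: [fs a] is regular at Q exactly when a is
    regular at f(Q). At a ramification point division by xi is replaced by an order argument, and 1
    generates O(D) because the q_i and the points at infinity are unramified. That p_+ and p_- are
    genuine poles needs uniqueness of the matrix in a basis: a regular connection would have a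
    regular matrix in the frame (1, xi). *)

Section Points.
Variables (F : numClosedFieldType) (X : hyperelliptic F).
Local Notation K := (funfield X).
Implicit Types (p : curve_point X) (g h z : K) (c : F) (A B R : {poly F}).
Implicit Types (N D : {poly {poly F}}).

(** Nested evaluation [N.[v, u]] is evaluation at the constant polynomial v followed by evaluation
    at u; as composites of morphisms, both evaluations become ring morphisms. *)
HB.instance Definition _ p :=
  GRing.RMorphism.copy (chart_poly p)
   (horner_eval (chart p).1 \o horner_eval ((chart p).2%:P) \o map_poly (map_poly (constf X))).
HB.instance Definition _ p :=
  GRing.RMorphism.copy (chart_poly_value p)
   (horner_eval (chart_value p).1 \o horner_eval ((chart_value p).2%:P)).

Lemma chart_polyC p A : chart_poly p A%:P = (map_poly (constf X) A).[(chart p).1].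
Proof. by rewrite /chart_poly map_polyC /= hornerC. Qed.

Lemma chart_polyX p : chart_poly p 'X = (chart p).2.
Proof. by rewrite /chart_poly map_polyX hornerX hornerC. Qed.

Lemma chart_poly_valueC p A : chart_poly_value p A%:P = A.[(chart_value p).1].
Proof. by rewrite /chart_poly_value hornerC. Qed.

Lemma chart_poly_valueX p : chart_poly_value p 'X = (chart_value p).2.
Proof. by rewrite /chart_poly_value hornerX hornerC. Qed.

Lemma ratfun_poly A : ratfun X A%:F = (map_poly (constf X) A).[coordx].
Proof.
elim/poly_ind: A => [|A c IH].
  by rewrite map_poly0 horner0 !rmorph0.
by rewrite !rmorphD !rmorphM /= map_polyX map_polyC /= !hornerE /= IH.
Qed.

Lemma coordy_sqr : (coordy : K) ^+ 2 = (map_poly (constf X) (rhs X)).[coordx].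
Proof. by rewrite -ratfun_poly; exact: ff_y_sqr. Qed.

Lemma coordx_nonconst c : (coordx : K) != c%:K.
Proof.
rewrite /coordx /constf (inj_eq (fmorph_inj _)) tofrac_eq.
by rewrite -subr_eq0 polyXsubC_eq0.
Qed.

Lemma coordx_neq0 : (coordx : K) != 0.
Proof. by have := coordx_nonconst 0; rewrite rmorph0. Qed.

Lemma coordxV_nonconst c : (coordx : K)^-1 != c%:K.
Proof.
rewrite -[c]invrK fmorphV (inj_eq invr_inj); exact: coordx_nonconst.
Qed.

(** Over an algebraically closed field A splits into linear factors, none of which vanishes at a
    nonconstant u. *)
Lemma nonconst_horner_neq0 (u : K) A : (forall c, u != c%:K) -> A != 0 ->
  (map_poly (constf X) A).[u] != 0.
Proof.
move=> nc A0; have [rs ->] := closed_field_poly_normal A.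
rewrite linearZ /= hornerZ mulf_neq0 ?fmorph_eq0 ?lead_coef_eq0 //.
rewrite rmorph_prod horner_prod prodf_seq_neq0; apply/allP => c _ /=.
by rewrite map_polyXsubC hornerXsubC subr_eq0 nc.
Qed.

(** At infinity this is the reversed polynomial s^(2g+2) P(1/s), the right-hand side of the equation
    between s = 1/u and w = v/u^(g+1). *)
Definition chart_rhs p : {poly F} :=
  match p with
  | AffinePoint _ _ _ => rhs X
  | InfinitePoint _ _ =>
      \poly_(i < (2 * genus X).+3) (rhs X)`_((2 * genus X).+2 - i)
  end.

Lemma chart1_nonconst p c : (chart p).1 != c%:K.
Proof. by case: p => /= *; [exact: coordx_nonconst | exact: coordxV_nonconst]. Qed.

Lemma chart_sqr p :
  (chart p).2 ^+ 2 = (map_poly (constf X) (chart_rhs p)).[(chart p).1].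
Proof.
case: p => [a b hab|w hw] /=; first exact: coordy_sqr.
rewrite expr_div_n coordy_sqr -exprM.
have x0 := coordx_neq0; set x := coordx in x0 *.
have /andP[_ sP] := size_rhs X.
have -> : ((genus X).+1 * 2 = (2 * genus X).+2)%N by lia.
move: (rhs X) sP => P; set n := (2 * genus X).+2 => sP.
rewrite map_polyE /= (@horner_coef_wide _ n.+1); last first.
  by rewrite -map_polyE (leq_trans (size_poly _ _)).
rewrite -map_polyE (@horner_coef_wide _ n.+1); last first.
  by rewrite (leq_trans (size_poly _ _)) // size_poly.
(* Dividing by x^(2g+2) turns x^i into x^-(2g+2-i), so the two sums match under i -> 2g+2-i. *)
rewrite mulr_suml (reindex_inj rev_ord_inj) /=; apply: eq_bigr => i _.
rewrite !coef_map coef_poly ltn_ord subSS; have := ltn_ord i; rewrite ltnS => lei.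
rewrite -mulrA; congr (_ * _).
move: (i : nat) lei => k lek.
by rewrite -{2}(subnK lek) exprD invfM mulrA mulfV ?expf_neq0 // mul1r exprVn.
Qed.

Lemma chart_value_sqr p :
  (chart_value p).2 ^+ 2 = (chart_rhs p).[(chart_value p).1].
Proof.
case: p => [a b hab|w hw] /=; first exact/eqP.
by rewrite horner_coef0 coef_poly subn0 /=; apply/eqP.
Qed.

(** At a finite point a common root with the derivative contradicts separability. At infinity w = 0
    means that the coefficient of degree 2g+2 vanishes, so the derivative at 0, the coefficient of
    degree 2g+1, is the leading one. *)
Lemma chart_smooth p : (chart_value p).2 = 0 ->
  (chart_rhs p)^`().[(chart_value p).1] != 0.
Proof.
case: p => [a b hab|w hw] /= b0.
  have r0 : root (rhs X) a by rewrite /root -(eqP hab) b0 expr0n.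
  have := separable_rhs X; rewrite unlock => /coprimep_root; exact.
rewrite horner_coef0 coef_deriv coef_poly /= mulr1n subn1 /=.
move: hw; rewrite b0 expr0n /= eq_sym => /eqP P0.
have /andP[s1 s2] := size_rhs X.
have e : size (rhs X) = (2 * genus X).+2.
  apply/eqP; rewrite eqn_leq s1 andbT; apply/leq_sizeP => j.
  rewrite leq_eqVlt => /orP[/eqP<- //|lj].
  by rewrite nth_default // (leq_trans s2).
by have := rhs_neq0 X; rewrite -lead_coef_eq0 lead_coefE e.
Qed.

(** Carries the uniqueness of coordinates on (1, [coordy]) over to (1, v) in either chart. *)
Lemma chart2_ratfun p : exists r, r != 0 /\ (chart p).2 = ratfun X r * coordy.
Proof.
case: p => [a b hab|w hw] /=.
  by exists 1; rewrite oner_neq0 rmorph1 mul1r.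
exists ('X%:F ^+ (genus X).+1)^-1; split.
  by rewrite invr_eq0 expf_neq0 // tofrac_eq0 polyX_eq0.
by rewrite fmorphV rmorphXn mulrC.
Qed.

Lemma horner_chart1_ratfun p A : exists r, (map_poly (constf X) A).[(chart p).1] = ratfun X r.
Proof.
have [s ->] : exists s, (chart p).1 = ratfun X s.
  case: p => [a b hab|w hw] /=; first by exists 'X%:F.
  by exists ('X%:F)^-1; rewrite fmorphV.
exists (map_poly (@FracField.tofrac _ \o polyC) A).[s].
by rewrite -horner_map -map_poly_comp.
Qed.

Lemma chart_free p A B :
  (map_poly (constf X) A).[(chart p).1]
    + (map_poly (constf X) B).[(chart p).1] * (chart p).2 = 0 -> A = 0 /\ B = 0.
Proof.
have nc := chart1_nonconst p.
have [r er] := horner_chart1_ratfun p A; have [s es] := horner_chart1_ratfun p B.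
have [k [k0 ->]] := chart2_ratfun p.
rewrite er es => e.
have := @funfield_coords_uniq _ X r (s * k) 0 0.
rewrite !rmorph0 mul0r addr0 rmorphM -mulrA => /(_ e)[r0 sk].
have s0 : s = 0 by apply/eqP; move/eqP: sk; rewrite mulf_eq0 (negPf k0) orbF.
split; apply/eqP; apply/contraT => /(nonconst_horner_neq0 nc).
  by rewrite er r0 rmorph0 eqxx.
by rewrite es s0 rmorph0 eqxx.
Qed.

(** Division by the monic polynomial v^2 - R, with a remainder of degree at most one in v. *)
Lemma poly2_reduce R N : exists A B M, N = A%:P + B%:P * 'X + M * ('X^2 - R%:P).
Proof.
elim/poly_ind: N => [|N A [A' [B [M ->]]]].
  by exists 0, 0, 0; rewrite !(mul0r, addr0) polyC0.
exists (A + B * R), A', (M * 'X + B%:P).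
by rewrite polyCD polyCM; ring.
Qed.

Lemma chart_poly_reduce p N A B M :
  N = A%:P + B%:P * 'X + M * ('X^2 - (chart_rhs p)%:P) ->
  chart_poly p N = (map_poly (constf X) A).[(chart p).1]
    + (map_poly (constf X) B).[(chart p).1] * (chart p).2 /\
  chart_poly_value p N =
    A.[(chart_value p).1] + B.[(chart_value p).1] * (chart_value p).2.
Proof.
move=> ->; split.
  rewrite !(rmorphD, rmorphM, rmorphN, rmorphXn) /= !chart_polyC chart_polyX.
  by rewrite -expr2 chart_sqr subrr mulr0 addr0.
rewrite !(rmorphD, rmorphM, rmorphN, rmorphXn) /= !chart_poly_valueC.
by rewrite chart_poly_valueX -expr2 chart_value_sqr subrr mulr0 addr0.
Qed.

(** By freeness of (1, v), a polynomial that is zero as a function is a multiple of v^2 - R, and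
    this relation also holds between the coordinates of the point. Values are therefore independent
    of the fraction chosen. *)
Lemma chart_poly_eq0 p N : chart_poly p N = 0 -> chart_poly_value p N = 0.
Proof.
have [A [B [M e]]] := poly2_reduce (chart_rhs p) N.
have [-> ->] := chart_poly_reduce e => /chart_free[-> ->].
by rewrite !horner0 mul0r addr0.
Qed.

(** The cofactor is the conjugate A - B v. The norm is nonzero, since a zero conjugate would force A
    = B = 0. *)
Lemma chart_poly_norm p N A B M :
  N = A%:P + B%:P * 'X + M * ('X^2 - (chart_rhs p)%:P) -> chart_poly p N != 0 ->
  exists N', [/\ A ^+ 2 - B ^+ 2 * chart_rhs p != 0,
    chart_poly p N * chart_poly p N' =
      (map_poly (constf X) (A ^+ 2 - B ^+ 2 * chart_rhs p)).[(chart p).1]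
   & chart_poly_value p N * chart_poly_value p N' =
     (A ^+ 2 - B ^+ 2 * chart_rhs p).[(chart_value p).1] ].
Proof.
move=> e.
have [] := chart_poly_reduce e.
pose N' : {poly {poly F}} := A%:P - B%:P * 'X => eN vN N0; exists N'.
have e' : N' = A%:P + (- B)%:P * 'X + 0 * ('X^2 - (chart_rhs p)%:P).
  by rewrite mul0r addr0 polyCN mulNr.
have [eN' vN'] := chart_poly_reduce e'.
have E : chart_poly p N * chart_poly p N' =
    (map_poly (constf X) (A ^+ 2 - B ^+ 2 * chart_rhs p)).[(chart p).1].
  rewrite eN eN' !(rmorphB, rmorphN, rmorphM, rmorphXn) /= !hornerE.
  by rewrite -chart_sqr; ring.
split=> //.
  apply/negP => /eqP H; move: E; rewrite H rmorph0 horner0 => /eqP.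
  rewrite mulf_eq0 (negPf N0) /= eN' => /eqP /chart_free [A0 /eqP].
  rewrite oppr_eq0 => /eqP B0; move: N0; rewrite eN A0 B0.
  by rewrite !(rmorph0, horner0) mul0r addr0 eqxx.
rewrite vN vN' !hornerE -chart_value_sqr; ring.
Qed.
End Points.

(** * Local rings and uniformizers *)

Section LocalRings.
Variables (F : numClosedFieldType) (X : hyperelliptic F).
Local Notation K := (funfield X).
Implicit Types (p : curve_point X) (f g h z : K) (c d : F) (A B R : {poly F}).
Implicit Types (N D : {poly {poly F}}).

(** Evaluation at p as a relation, which avoids choosing a fraction: it is functional by
    [value_at_uniq], and its domain is the local ring. *)
Definition value_at p g c := exists N D, [/\ chart_poly_value p D != 0,
  g * chart_poly p D = chart_poly p N & c * chart_poly_value p D = chart_poly_value p N].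

Lemma chart_poly_neq0 p D : chart_poly_value p D != 0 -> chart_poly p D != 0.
Proof. by apply: contra_neq => /chart_poly_eq0. Qed.

Lemma local_ringP p g : local_ring p g <-> exists c, value_at p g c.
Proof.
split=> [[N [D [D0 e]]]|[c [N [D [D0 e _]]]]]; last by exists N, D.
by exists (chart_poly_value p N / chart_poly_value p D), N, D; split; rewrite ?divfK.
Qed.

Lemma maximal_idealP p g : maximal_ideal p g <-> value_at p g 0.
Proof.
split=> [[N [D [D0 N0 e]]]|[N [D [D0 e N0]]]].
  by exists N, D; split; rewrite ?mul0r ?N0.
by exists N, D; split; rewrite // -N0 mul0r.
Qed.

Lemma value_at_local p g c : value_at p g c -> local_ring p g.
Proof. by move=> gc; apply/local_ringP; exists c. Qed.

Lemma value_at_uniq p g c d : value_at p g c -> value_at p g d -> c = d.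
Proof.
move=> [N [D [D0 e v]]] [N' [D' [D'0 e' v']]].
have : chart_poly p (N * D' - N' * D) = 0.
  by rewrite rmorphD rmorphN !rmorphM /= -e -e'; ring.
move/chart_poly_eq0; rewrite rmorphD rmorphN !rmorphM /= -v -v' => H.
have : (c - d) * (chart_poly_value p D * chart_poly_value p D') = 0.
  by rewrite -[RHS]H; ring.
by move/eqP; rewrite !mulf_eq0 (negPf D0) (negPf D'0) !orbF subr_eq0 => /eqP.
Qed.

Lemma value_at_poly p N : value_at p (chart_poly p N) (chart_poly_value p N).
Proof. by exists N, 1; rewrite !rmorph1 oner_neq0 !mulr1. Qed.

Lemma value_at_const p c : value_at p c%:K c.
Proof.
have := value_at_poly p (c%:P%:P).
by rewrite chart_polyC chart_poly_valueC map_polyC !hornerC.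
Qed.

Lemma value_at_chart1 p : value_at p (chart p).1 (chart_value p).1.
Proof.
have := value_at_poly p ('X%:P).
by rewrite chart_polyC chart_poly_valueC map_polyX !hornerX.
Qed.

Lemma value_at_chart2 p : value_at p (chart p).2 (chart_value p).2.
Proof. by have := value_at_poly p 'X; rewrite chart_polyX chart_poly_valueX. Qed.

Lemma value_atD p g h c d :
  value_at p g c -> value_at p h d -> value_at p (g + h) (c + d).
Proof.
move=> [N [D [D0 e v]]] [N' [D' [D'0 e' v']]].
exists (N * D' + N' * D), (D * D').
by rewrite !(rmorphD, rmorphM) /= -e -e' -v -v' mulf_neq0 //; split=> //; ring.
Qed.

Lemma value_atM p g h c d :
  value_at p g c -> value_at p h d -> value_at p (g * h) (c * d).
Proof.
move=> [N [D [D0 e v]]] [N' [D' [D'0 e' v']]]; exists (N * N'), (D * D').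
by rewrite !(rmorphM) /= -e -e' -v -v' mulf_neq0 //; split=> //; ring.
Qed.

Lemma value_atV p g c : c != 0 -> value_at p g c -> value_at p g^-1 c^-1.
Proof.
move=> c0 [N [D [D0 e v]]].
have N0 : chart_poly_value p N != 0 by rewrite -v mulf_neq0.
have g0 : g != 0.
  by apply: contra_neq (chart_poly_neq0 N0) => g0; rewrite -e g0 mul0r.
by exists D, N; rewrite N0 -e -v !mulKf.
Qed.

Lemma value_at_unit_neq0 p g c : c != 0 -> value_at p g c -> g != 0.
Proof.
move=> c0 gc; apply: contra_neq c0 => g0; apply: value_at_uniq gc _.
by rewrite g0 -(rmorph0 (constf X)); exact: value_at_const.
Qed.

Lemma value_atN p g c : value_at p g c -> value_at p (- g) (- c).
Proof.
move=> gc; have := value_atM (value_at_const p (-1)) gc.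
by rewrite rmorphN rmorph1 !mulN1r.
Qed.

Lemma value_atB p g h c d :
  value_at p g c -> value_at p h d -> value_at p (g - h) (c - d).
Proof. by move=> gc /value_atN; exact: value_atD. Qed.

Lemma value_at0 p : value_at p 0 0.
Proof. by have := value_at_const p 0; rewrite rmorph0. Qed.

Lemma value_at1 p : value_at p 1 1.
Proof. by have := value_at_const p 1; rewrite rmorph1. Qed.

Lemma value_atX p g c n : value_at p g c -> value_at p (g ^+ n) (c ^+ n).
Proof.
move=> gc; elim: n => [|n IH]; first by rewrite !expr0; exact: value_at1.
by rewrite !exprS; exact: value_atM.
Qed.

Lemma value_at_mul0l p g h : value_at p g 0 -> local_ring p h -> value_at p (g * h) 0.
Proof. by move=> g0 /local_ringP[c hc]; rewrite -(mul0r c); exact: value_atM. Qed.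

Lemma value_at_horner p A g c : value_at p g c ->
  value_at p (map_poly (constf X) A).[g] A.[c].
Proof.
move=> gc; elim/poly_ind: A => [|A d IH].
  by rewrite map_poly0 !horner0; exact: value_at0.
rewrite rmorphD rmorphM /= map_polyX map_polyC !hornerE /=.
by apply: value_atD; [exact: value_atM | exact: value_at_const].
Qed.

Lemma local_const p c : local_ring p c%:K.
Proof. exact/value_at_local/value_at_const. Qed.

Lemma local0 p : local_ring p 0.
Proof. exact/value_at_local/value_at0. Qed.

Lemma local1 p : local_ring p 1.
Proof. exact/value_at_local/value_at1. Qed.

Lemma localD p g h : local_ring p g -> local_ring p h -> local_ring p (g + h).
Proof.
by move=> /local_ringP[c gc] /local_ringP[d hd]; exact: value_at_local (value_atD gc hd).
Qed.

Lemma localM p g h : local_ring p g -> local_ring p h -> local_ring p (g * h).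
Proof.
by move=> /local_ringP[c gc] /local_ringP[d hd]; exact: value_at_local (value_atM gc hd).
Qed.

Lemma localN p g : local_ring p g -> local_ring p (- g).
Proof. by move=> /local_ringP[c gc]; exact: value_at_local (value_atN gc). Qed.

Lemma localB p g h : local_ring p g -> local_ring p h -> local_ring p (g - h).
Proof. by move=> ? /localN; exact: localD. Qed.

Lemma localX p g n : local_ring p g -> local_ring p (g ^+ n).
Proof. by move=> /local_ringP[c gc]; exact: value_at_local (value_atX n gc). Qed.

Lemma uniformizer_max p z : uniformizer p z -> value_at p z 0.
Proof. by case=> /maximal_idealP. Qed.

Lemma uniformizer_neq0 p z : uniformizer p z -> z != 0.
Proof.
case=> _ zP; apply/negP => /eqP z0.
have /zP[h _] : maximal_ideal p ((chart p).1 - ((chart_value p).1)%:K).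
  apply/maximal_idealP; rewrite -(subrr (chart_value p).1).
  by apply: value_atB; [exact: value_at_chart1 | exact: value_at_const].
rewrite z0 mulr0 => /eqP; rewrite subr_eq0; apply/negP; exact: chart1_nonconst.
Qed.

Lemma uniformizer_div p z g : uniformizer p z -> value_at p g 0 -> local_ring p (g / z).
Proof.
move=> uz; have z0 := uniformizer_neq0 uz.
by case: uz => _ zP /maximal_idealP/zP[h lh ->]; rewrite mulfK.
Qed.

(** Both quotients are regular and their product is 1, so neither value can be zero. *)
Lemma uniformizer_unit p z z' : uniformizer p z -> uniformizer p z' ->
  exists2 c, c != 0 & value_at p (z' / z) c.
Proof.
move=> uz uz'; have z0 := uniformizer_neq0 uz; have z0' := uniformizer_neq0 uz'.
have /local_ringP[c cP] := uniformizer_div uz (uniformizer_max uz').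
have /local_ringP[d dP] := uniformizer_div uz' (uniformizer_max uz).
exists c => //; have := value_atM cP dP.
rewrite mulrA divfK // mulfV // => H1; apply/eqP => c0.
move: (value_at_uniq H1 (value_at1 p)); rewrite c0 mul0r => /esym/eqP.
by rewrite oner_eq0.
Qed.

(** N - N(p) lies in the ideal generated by u - a and v - b, by induction on the degree in v and,
    for each coefficient, on the degree in u. *)
Lemma chart_poly_div p N z : z != 0 ->
  local_ring p (((chart p).1 - ((chart_value p).1)%:K) / z) ->
  local_ring p (((chart p).2 - ((chart_value p).2)%:K) / z) ->
  chart_poly_value p N = 0 -> local_ring p (chart_poly p N / z).
Proof.
move=> z0 l1 l2 N0.
suff : local_ring p ((chart_poly p N - (chart_poly_value p N)%:K) / z).
  by rewrite N0 rmorph0 subr0.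
elim/poly_ind: N {N0} => [|N A IH]; first by rewrite !rmorph0 subrr mul0r; exact: local0.
have lA : local_ring p ((chart_poly p A%:P - (chart_poly_value p A%:P)%:K) / z).
  rewrite chart_polyC chart_poly_valueC; elim/poly_ind: A {IH} => [|A c IHA].
    by rewrite map_poly0 !horner0 !rmorph0 subrr mul0r; exact: local0.
  rewrite !(rmorphD, rmorphM) /= map_polyX map_polyC !hornerE !(rmorphD, rmorphM) /=.
  set u := (chart p).1 in l1 IHA *; set a := (chart_value p).1 in l1 IHA *.
  rewrite [X in local_ring p X](_ : _ = ((map_poly (constf X) A).[u] - (A.[a])%:K) / z * u
     + (A.[a])%:K * ((u - a%:K) / z)); last by field.
  by apply: localD; apply: localM => //;
    first [exact: local_const | exact: value_at_local (value_at_chart1 p)].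
rewrite !(rmorphD, rmorphM) /= chart_polyX chart_poly_valueX.
set P := chart_poly p N in IH *; set v := chart_poly_value p N in IH *.
set P' := chart_poly p _ in lA *; set v' := chart_poly_value p _ in lA *.
set u := (chart p).2 in l2 *; set a := (chart_value p).2 in l2 *.
rewrite [X in local_ring p X](_ : _ = (P - v%:K) / z * u
     + v%:K * ((u - a%:K) / z) + (P' - v'%:K) / z); last by field.
apply: localD => //.
by apply: localD; apply: localM => //;
    first [exact: local_const | exact: value_at_local (value_at_chart2 p)].
Qed.

Lemma uniformizer_intro p z : z != 0 -> value_at p z 0 ->
  local_ring p (((chart p).1 - ((chart_value p).1)%:K) / z) ->
  local_ring p (((chart p).2 - ((chart_value p).2)%:K) / z) -> uniformizer p z.
Proof.
move=> z0 vz l1 l2; split; first exact/maximal_idealP.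
move=> g [N [D [D0 N0 e]]]; exists (g / z); last by rewrite divfK.
have dP := value_atV D0 (value_at_poly p D).
rewrite (_ : g = chart_poly p N * (chart_poly p D)^-1); last first.
  by rewrite -e mulfK ?chart_poly_neq0.
rewrite mulrAC; apply: localM; last exact: value_at_local dP.
exact: chart_poly_div.
Qed.

(* Where the chart coordinate v is nonzero, R(u) - R(alpha) = v^2 - beta^2
   makes u - alpha divide v - beta. *)
Lemma uniformizer_chart1 p : (chart_value p).2 != 0 ->
  uniformizer p ((chart p).1 - ((chart_value p).1)%:K).
Proof.
set u := (chart p).1; set v := (chart p).2.
set a := (chart_value p).1; set b := (chart_value p).2 => b0.
have z0 : u - a%:K != 0 by rewrite subr_eq0 chart1_nonconst.
have ua : value_at p u a := value_at_chart1 p.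
have vb : value_at p v b := value_at_chart2 p.
have [Q eQ] : exists Q, chart_rhs p - ((chart_rhs p).[a])%:P = Q * ('X - a%:P).
  by apply/factor_theorem; rewrite /root !hornerE subrr.
have e : (v - b%:K) * (v + b%:K) = (map_poly (constf X) Q).[u] * (u - a%:K).
  have := congr1 (fun A => (map_poly (constf X) A).[u]) eQ.
  rewrite /= !(rmorphB, rmorphM) /= map_polyC map_polyX map_polyC !hornerE /=.
  by rewrite -chart_sqr -chart_value_sqr rmorphXn /= => <-; rewrite -subr_sqr.
have bb0 : b + b != 0 by rewrite -mulr2n mulrn_eq0.
have wP : value_at p (v + b%:K) (b + b).
  by apply: value_atD => //; exact: value_at_const.
have w0 := value_at_unit_neq0 bb0 wP.
apply: uniformizer_intro => //; rewrite -/u -/v -/a -/b.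
- by rewrite -(subrr a); apply: value_atB => //; exact: value_at_const.
- by rewrite divff //; exact: local1.
rewrite (_ : _ / _ = (map_poly (constf X) Q).[u] / (v + b%:K)); last first.
  by apply/eqP; rewrite eqr_div // e.
apply: localM; last exact: value_at_local (value_atV bb0 wP).
exact: value_at_local (value_at_horner Q ua).
Qed.

(** Here a is a simple root of R, so v^2 = Q(u) (u - a) with Q(a) nonzero, and u - a is v times v /
    Q(u). *)
Lemma uniformizer_chart2 p : (chart_value p).2 = 0 -> uniformizer p (chart p).2.
Proof.
move=> b0; have := chart_smooth b0; have := chart_value_sqr p; rewrite b0 expr0n /=.
set a := (chart_value p).1; set u := (chart p).1; set v := (chart p).2.
move/esym/eqP => /factor_theorem[Q eQ]; rewrite eQ derivM derivXsubC !hornerE subrr.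
rewrite mulr0 add0r => Qa0.
have ua : value_at p u a := value_at_chart1 p.
have vb : value_at p v 0 by rewrite -b0; exact: value_at_chart2 p.
have e : v * v = (map_poly (constf X) Q).[u] * (u - a%:K).
  by rewrite -expr2 chart_sqr eQ rmorphM /= map_polyXsubC hornerM hornerXsubC.
have QP := value_at_horner Q ua.
have Q0 := value_at_unit_neq0 Qa0 QP.
have v0 : v != 0.
  apply/eqP => v0; move/eqP: e; rewrite v0 mul0r eq_sym mulf_eq0 (negPf Q0) /= subr_eq0.
  by apply/negP; exact: chart1_nonconst.
apply: uniformizer_intro => //; rewrite -/u -/v -/a ?b0.
  rewrite (_ : _ / _ = v / (map_poly (constf X) Q).[u]); last first.
    by apply/eqP; rewrite eqr_div // e mulrC.
  by apply: localM; apply: value_at_local; [exact: vb | exact: value_atV QP].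
by rewrite rmorph0 subr0 divff //; exact: local1.
Qed.

Lemma uniformizer_exists p : exists z, uniformizer p z.
Proof.
have [b0|b0] := eqVneq (chart_value p).2 0.
  by exists (chart p).2; exact: uniformizer_chart2.
by exists ((chart p).1 - ((chart_value p).1)%:K); exact: uniformizer_chart1.
Qed.

Lemma not_local_uniformizerV p z : uniformizer p z -> ~ local_ring p z^-1.
Proof.
move=> uz lz; have := value_at_mul0l (uniformizer_max uz) lz.
rewrite mulfV ?(uniformizer_neq0 uz) // => /(value_at_uniq (value_at1 p))/eqP.
by rewrite oner_eq0.
Qed.

(** The factor u - a has order 1 or 2 at p according to whether v(p) is nonzero or zero; what
    remains of A after removing all factors u - a is a unit. *)
Lemma unit_power_poly p z A : uniformizer p z -> A != 0 -> exists n h c,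
  [/\ c != 0, value_at p h c & (map_poly (constf X) A).[(chart p).1] = h * z ^+ n].
Proof.
move=> uz A0.
have H1 : exists n h c, [/\ c != 0, value_at p h c
    & (chart p).1 - ((chart_value p).1)%:K = h * z ^+ n].
  have [b0|b0] := eqVneq (chart_value p).2 0; last first.
    have [c c0 cP] := uniformizer_unit uz (uniformizer_chart1 b0).
    by exists 1%N, (((chart p).1 - ((chart_value p).1)%:K) / z), c;
      rewrite expr1 divfK ?(uniformizer_neq0 uz).
  have [c c0 cP] := uniformizer_unit uz (uniformizer_chart2 b0).
  have := chart_smooth b0; have := chart_value_sqr p; rewrite b0 expr0n /=.
  have := value_at_chart1 p.
  set a := (chart_value p).1; set u := (chart p).1; set v := (chart p).2 in cP *.
  move=> ua /esym/eqP => /factor_theorem[Q eQ]; rewrite eQ derivM derivXsubC !hornerE subrr.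
  rewrite mulr0 add0r => Qa0.
  have e : v * v = (map_poly (constf X) Q).[u] * (u - a%:K).
    by rewrite -expr2 chart_sqr eQ rmorphM /= map_polyXsubC hornerM hornerXsubC.
  have QP := value_at_horner Q ua.
  have Q0 := value_at_unit_neq0 Qa0 QP.
  exists 2%N, ((v / z) * (v / z) / (map_poly (constf X) Q).[u]), (c * c / Q.[a]).
  split; first by rewrite !mulf_neq0 ?invr_eq0.
    by apply: value_atM; [exact: value_atM | exact: value_atV].
  rewrite mulf_div e expr2; field.
  by rewrite Q0 (uniformizer_neq0 uz).
have [m [Q [Qa0 ->]]] : exists m Q,
    Q.[(chart_value p).1] != 0 /\ A = Q * ('X - (chart_value p).1%:P) ^+ m.
  have [m [Q]] := multiplicity_XsubC A (chart_value p).1; rewrite A0 /= => Qa eA.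
  by exists m, Q; split.
have [n [h [c [c0 hc e]]]] := H1.
exists (n * m)%N, ((map_poly (constf X) Q).[(chart p).1] * h ^+ m),
   (Q.[(chart_value p).1] * c ^+ m); split.
- by rewrite mulf_neq0 ?expf_neq0.
- by apply: value_atM; [exact/value_at_horner/value_at_chart1 | exact: value_atX].
rewrite rmorphM rmorphXn /= map_polyXsubC hornerM horner_exp hornerXsubC e.
by rewrite exprMn -exprM mulrA.
Qed.

(** Divides by z as long as the value is zero; the exponent m bounds the number of divisions. *)
Lemma local_factor p z g : uniformizer p z -> local_ring p g ->
  (exists m, ~ local_ring p (g / z ^+ m)) ->
  exists n h c, [/\ c != 0, value_at p h c & g = h * z ^+ n].
Proof.
move=> uz lg [m nm]; have z0 := uniformizer_neq0 uz.
elim: m g lg nm => [|m IH] g lg nm; first by case: nm; rewrite expr0 divr1.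
have [c gc] := (local_ringP p g).1 lg.
have [c0|c0] := eqVneq c 0; last by exists 0%N, g, c; rewrite expr0 mulr1.
rewrite c0 in gc.
have [||n [h [d [d0 hd e]]]] := IH (g / z); first exact: uniformizer_div.
  by rewrite -mulrA -invfM -exprS.
by exists n.+1, h, d; split=> //; rewrite exprSr mulrA -e divfK.
Qed.

Lemma unit_power_chart_poly p z N : uniformizer p z -> chart_poly p N != 0 ->
  exists n h c, [/\ c != 0, value_at p h c & chart_poly p N = h * z ^+ n].
Proof.
move=> uz N0; have z0 := uniformizer_neq0 uz.
apply: local_factor => //; first exact: value_at_local (value_at_poly p _).
have [A [B [M e]]] := poly2_reduce (chart_rhs p) N.
have [N' [A0 eN _]] := chart_poly_norm e N0.
have [n [h [c [c0 hc eh]]]] := unit_power_poly uz A0.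
(* If N / z^(n+1) were regular, so would be its product with the conjugate of N, which is the norm
   over z^(n+1), a unit divided by z. *)
exists n.+1 => H; apply: (not_local_uniformizerV uz).
have h0 := value_at_unit_neq0 c0 hc.
have -> : z^-1 = chart_poly p N / z ^+ n.+1 * chart_poly p N' * h^-1.
  rewrite [_ / _ * chart_poly p N']mulrAC eN eh exprS; field; rewrite h0 z0 expf_neq0 //.
apply: localM; last exact: value_at_local (value_atV c0 hc).
by apply: localM => //; exact: value_at_local (value_at_poly p _).
Qed.

(** Fractions of chart polynomials form a subfield containing the constants, x and y. In the chart
    at infinity, x and y are recovered from 1/x and y/x^(g+1). *)
Lemma chart_generates p g : exists N D, chart_poly p D != 0 /\ g * chart_poly p D = chart_poly p N.
Proof.
pose P g := exists N D, chart_poly p D != 0 /\ g * chart_poly p D = chart_poly p N.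
have PD f h : P f -> P h -> P (f + h).
  move=> [N [D [D0 e]]] [N' [D' [D0' e']]]; exists (N * D' + N' * D), (D * D').
  by rewrite !(rmorphD, rmorphM) /= -e -e' mulf_neq0 //; split=> //; ring.
have PM f h : P f -> P h -> P (f * h).
  move=> [N [D [D0 e]]] [N' [D' [D0' e']]]; exists (N * N'), (D * D').
  by rewrite !rmorphM /= -e -e' mulf_neq0 //; split=> //; ring.
have PV f : P f -> P f^-1.
  move=> [N [D [D0 e]]]; have [->|f0] := eqVneq f 0.
    by exists 0, 1; rewrite rmorph1 oner_neq0 invr0 mul0r rmorph0.
  by exists D, N; rewrite -e mulf_neq0 // mulKf.
have Pp N : P (chart_poly p N) by exists N, 1; rewrite rmorph1 oner_neq0 mulr1.
have Pc c : P c%:K by have := Pp c%:P%:P; rewrite chart_polyC map_polyC hornerC.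
have Px : P coordx.
  have : P (chart p).1 by have := Pp 'X%:P; rewrite chart_polyC map_polyX hornerX.
  by case: (p) => //= w _ /PV; rewrite invrK.
have PX n : P (coordx ^+ n).
  elim: n => [|n IH]; last by rewrite exprS; exact: PM.
  by rewrite expr0 -(rmorph1 (constf X)); exact: Pc.
have Py : P coordy.
  have := Pp 'X; rewrite chart_polyX.
  case: (p) => //= w _ /PM/(_ (PX (genus X).+1)); rewrite divfK //.
  by rewrite expf_neq0 ?coordx_neq0.
have PA A : P (ratfun X A%:F).
  elim/poly_ind: A => [|A c IH]; first by rewrite -polyC0; exact: Pc.
  by rewrite !(rmorphD, rmorphM); apply: (PD _ _ _ (Pc c)); exact: PM.
have Pr r : P (ratfun X r).
  elim/fraction_ind: r => a b _; rewrite fmorph_div; exact: PM (PA _) (PV _ (PA _)).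
have [r [s ->]] := ff_span g.
by apply: PD => //; apply: PM.
Qed.

Lemma unit_power p z g : uniformizer p z -> g != 0 ->
  exists (n : int) h c, [/\ c != 0, value_at p h c & g = h * z ^ n].
Proof.
move=> uz g0; have z0 := uniformizer_neq0 uz.
have [N [D [D0 e]]] := chart_generates p g.
have N0 : chart_poly p N != 0 by rewrite -e mulf_neq0.
have [n [h [c [c0 hc eN]]]] := unit_power_chart_poly uz N0.
have [m [k [d [d0 kd eD]]]] := unit_power_chart_poly uz D0.
exists (n%:Z - m%:Z), (h / k), (c / d); split; first by rewrite mulf_neq0 ?invr_eq0.
  by apply: value_atM => //; exact: value_atV.
rewrite expfzDr // -exprnN -exprnP; apply: (mulIf D0); rewrite e eN eD.
have k0 := value_at_unit_neq0 d0 kd.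
by field; rewrite expf_neq0 // k0.
Qed.

(** Writing g = h z^n with h a unit, non-regularity forces n < 0, so the inverse carries at least
    one factor z. *)
Lemma not_local_value0 p g : ~ local_ring p g -> value_at p g^-1 0.
Proof.
move=> ng; have [z uz] := uniformizer_exists p.
have g0 : g != 0 by apply/eqP => g0; apply: ng; rewrite g0; exact: local0.
have [[n|n] [h [c [c0 hc e]]]] := unit_power uz g0.
  case: ng; rewrite e; apply: localM; first exact: value_at_local hc.
  exact/localX/value_at_local/uniformizer_max.
rewrite e invfM NegzE -exprnN invrK exprS mulrC -mulrA.
apply: value_at_mul0l; first exact: uniformizer_max.
apply: localM; first exact/localX/value_at_local/uniformizer_max.
exact: value_at_local (value_atV c0 hc).
Qed.

Lemma unit_local_iff p u c g : c != 0 -> value_at p u c ->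
  local_ring p (u * g) <-> local_ring p g.
Proof.
move=> c0 uc; have u0 := value_at_unit_neq0 c0 uc; split=> [H|]; last first.
  by apply: localM; exact: value_at_local uc.
by rewrite -(mulKf u0 g); apply: localM H; exact: value_at_local (value_atV c0 uc).
Qed.

Lemma value_atXz p u c (n : int) : c != 0 -> value_at p u c -> value_at p (u ^ n) (c ^ n).
Proof.
move=> c0 uc; case: n => n; first exact: value_atX.
by rewrite NegzE -!exprnN -!exprVn; apply: value_atX; exact: value_atV.
Qed.

(** The uniformizer bound inside [ord_ge] can be traded for any fixed one, since their quotient is a
    unit. *)
Lemma ord_geE p z (n : int) g : uniformizer p z ->
  ord_ge p n g <-> local_ring p (g / z ^ n).
Proof.
move=> uz; have z0 := uniformizer_neq0 uz; split; last first.
  by move=> H; exists z, (g / z ^ n); split; rewrite // divfK ?expfz_neq0.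
move=> [z' [h [uz' lh ->]]]; have [c c0 cP] := uniformizer_unit uz uz'.
rewrite -mulrA expfV -expfzMl; apply: localM => //.
exact: value_at_local (value_atXz n c0 cP).
Qed.
End LocalRings.

(** * Differentials *)

Section Differentials.
Variables (F : numClosedFieldType) (X : hyperelliptic F).
Local Notation K := (funfield X).
Local Notation "'d" := (ddx X : K -> K).
Implicit Types (p : curve_point X) (f g h z w : K) (c : F) (A B R : {poly F}).
Implicit Types (N D : {poly {poly F}}).

Lemma ddx_polyE A g : 'd (map_poly (constf X) A).[g] = (map_poly (constf X) A^`()).[g] * 'd g.
Proof.
elim/poly_ind: A => [|A c IH].
  by rewrite deriv0 map_poly0 horner0 mul0r -(rmorph0 (constf X)) dx_fun_const rmorph0.
rewrite derivD derivM derivX derivC addr0 mulr1 !(rmorphD, rmorphM) /= map_polyX map_polyC.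
rewrite !hornerE /= dx_funD dx_funM dx_fun_const IH; ring.
Qed.

Lemma ddx1 : 'd 1 = 0.
Proof. by rewrite -(rmorph1 (constf X)) dx_fun_const. Qed.

Lemma ddx0 : 'd 0 = 0.
Proof. by rewrite -(rmorph0 (constf X)) dx_fun_const rmorph0. Qed.

Lemma ddxN g : 'd (- g) = - 'd g.
Proof. by apply/eqP; rewrite -addr_eq0 -dx_funD addrC subrr ddx0. Qed.

Lemma ddxB g h : 'd (g - h) = 'd g - 'd h.
Proof. by rewrite dx_funD ddxN. Qed.

Lemma ddxV g : g != 0 -> 'd g^-1 = - 'd g / g ^+ 2.
Proof.
move=> g0; have := dx_funM (ddx X) g g^-1; rewrite divff // ddx1 => e.
apply: (mulfI g0); apply/eqP; rewrite -subr_eq0; apply/eqP.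
rewrite [RHS]e; by field.
Qed.

Lemma ddx_chart1_neq0 p : 'd (chart p).1 != 0.
Proof.
case: p => [a b hab|w hw] /=; first by rewrite dx_fun_x oner_neq0.
rewrite ddxV ?coordx_neq0 // dx_fun_x mulN1r oppr_eq0 invr_eq0 expf_neq0 //.
exact: coordx_neq0.
Qed.

Lemma ddx_chart p : 2 * (chart p).2 * 'd (chart p).2 =
  (map_poly (constf X) (chart_rhs p)^`()).[(chart p).1] * 'd (chart p).1.
Proof.
rewrite -ddx_polyE -chart_sqr expr2 dx_funM; ring.
Qed.

(** Every dg is a regular combination of du and dv. The free denominator [w] allows the two possible
    choices of differential to be treated alike. *)
Lemma ddx_local_chart p w g :
  local_ring p ('d (chart p).1 / w) -> local_ring p ('d (chart p).2 / w) ->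
  local_ring p g -> local_ring p ('d g / w).
Proof.
move=> l1 l2.
have lN N : local_ring p ('d (chart_poly p N) / w).
  elim/poly_ind: N => [|N A IH].
    by rewrite rmorph0 ddx0 mul0r; exact: local0.
  rewrite !(rmorphD, rmorphM) /= chart_polyX chart_polyC dx_funD dx_funM ddx_polyE.
  rewrite [X in local_ring p X](_ : _ = 'd (chart_poly p N) / w * (chart p).2 +
     chart_poly p N * ('d (chart p).2 / w) +
     (map_poly (constf X) A^`()).[(chart p).1] * ('d (chart p).1 / w)); last by ring.
  have lA := value_at_local (value_at_horner A^`() (value_at_chart1 p)).
  have lv := value_at_local (value_at_chart2 p).
  have lN := value_at_local (value_at_poly p N).
  by apply: localD; [apply: localD|]; exact: localM.
move=> [N [D [D0 e]]].
have DK0 := chart_poly_neq0 D0.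
(* Differentiating g D = N gives dg = (dN - g dD) / D, where D is a unit at p. *)
have := congr1 'd e; rewrite dx_funM => e'.
rewrite (_ : 'd g / w = ('d (chart_poly p N) / w - g * ('d (chart_poly p D) / w))
   * (chart_poly p D)^-1); last first.
  by rewrite mulrA -mulrBl -e' addrK mulrAC mulfK.
apply: localM; last exact: value_at_local (value_atV D0 (value_at_poly p D)).
by apply: localB => //; apply: localM => //; exists N, D.
Qed.

(** In 2 v dv = R'(u) du, the factor R'(u) is a unit where v(p) = 0, so dv generates there;
    elsewhere 2 v is a unit and du generates. *)
Lemma ddx_uniformizer_exists p : exists z, [/\ uniformizer p z, 'd z != 0 &
  forall g, local_ring p g -> local_ring p ('d g / 'd z)].
Proof.
have n2 : 2 != 0 :> F by rewrite pnatr_eq0.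
have d0 := ddx_chart1_neq0 p; have e := ddx_chart p.
have [b0|b0] := eqVneq (chart_value p).2 0.
  have R0 := chart_smooth b0.
  have RP := value_at_horner (chart_rhs p)^`() (value_at_chart1 p).
  have RK0 := value_at_unit_neq0 R0 RP.
  have dv0 : 'd (chart p).2 != 0.
    by apply/eqP => dv; move/eqP: e; rewrite dv mulr0 eq_sym mulf_eq0 (negPf RK0) (negPf d0).
  exists (chart p).2; split=> //; first exact: uniformizer_chart2.
  move=> g; apply: ddx_local_chart; last by rewrite divff //; exact: local1.
  rewrite (_ : _ / _ = 2%:K * (chart p).2 / (map_poly (constf X) (chart_rhs p)^`()).[(chart p).1]).
    apply: localM; last exact: value_at_local (value_atV R0 RP).
    by apply: localM; [exact: local_const | exact: value_at_local (value_at_chart2 p)].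
  by apply/eqP; rewrite eqr_div // rmorph_nat e mulrC.
have vP := value_at_chart2 p; have v0 := value_at_unit_neq0 b0 vP.
have tP : value_at p 2%:K 2 := value_at_const p 2.
have t0 := value_at_unit_neq0 n2 tP.
exists ((chart p).1 - ((chart_value p).1)%:K).
rewrite ddxB dx_fun_const subr0; split=> //; first exact: uniformizer_chart1.
move=> g; apply: ddx_local_chart; first by rewrite divff //; exact: local1.
rewrite (_ : _ / _ = (map_poly (constf X) (chart_rhs p)^`()).[(chart p).1] / (2%:K * (chart p).2)).
  apply: localM; first exact: value_at_local (value_at_horner _ (value_at_chart1 p)).
  by apply: value_at_local (value_atV _ (value_atM tP vP)); rewrite mulf_neq0.
by apply/eqP; rewrite eqr_div ?mulf_neq0 // rmorph_nat -e; apply/eqP; ring.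
Qed.

(** Passes from the chart uniformizer z0 to any z: with z0 = k z, dividing dz0 = k dz + z dk by dz0
    gives k dz / dz0 = 1 - z dk / dz0, which has value 1 at p. *)
Lemma ddx_uniformizer p z : uniformizer p z -> 'd z != 0 /\
  forall g, local_ring p g -> local_ring p ('d g / 'd z).
Proof.
move=> uz; have [z0 [uz0 dz0 H]] := ddx_uniformizer_exists p.
have z1 := uniformizer_neq0 uz.
have := uniformizer_div uz (uniformizer_max uz0); set k := z0 / z => lk.
have ek : z0 = k * z by rewrite divfK.
have lz := value_at_local (uniformizer_max uz).
have e1 : k * ('d z / 'd z0) = 1 - z * ('d k / 'd z0).
  have := congr1 'd ek; rewrite dx_funM => e2.
  by rewrite -[1](divff dz0) {2}e2; ring.
have v1 : value_at p (k * ('d z / 'd z0)) 1.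
  rewrite e1 -[X in value_at p _ X]subr0; apply: value_atB; first exact: value_at1.
  by apply: value_at_mul0l; [exact: uniformizer_max | exact: H].
have kd0 := value_at_unit_neq0 (oner_neq0 F) v1.
have k0 : k != 0 by apply: contraNneq kd0 => ->; rewrite mul0r.
have dz : 'd z != 0 by apply: contraNneq kd0 => ->; rewrite mul0r mulr0.
split=> // g lg.
rewrite (_ : _ / _ = 'd g / 'd z0 * (k * (k * ('d z / 'd z0))^-1)).
  apply: localM; first exact: H.
  by apply: localM => //; exact: value_at_local (value_atV (oner_neq0 F) v1).
by field; rewrite dz k0 dz0.
Qed.

Lemma form_ord_geE p z (n : int) (eta : Omega X) : uniformizer p z ->
  form_ord_ge p n eta <-> local_ring p ((eta : K) / (z ^ n * 'd z)).
Proof.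
move=> uz; have z0 := uniformizer_neq0 uz; have [dz0 dP] := ddx_uniformizer uz.
split; last first.
  move=> H; exists z, ((eta : K) / (z ^ n * 'd z)); split=> //.
  rewrite /diff /GRing.scale /=; have := expfz_neq0 n z0.
  by move: (z ^ n) => w w0; field; rewrite dz0 w0.
move=> [z' [h [uz' lh ->]]]; have [c c0 cP] := uniformizer_unit uz uz'.
rewrite /diff /GRing.scale /=.
rewrite (_ : _ / _ = h * (z' / z) ^ n * ('d z' / 'd z)).
  apply: localM; last by apply: dP; exact: value_at_local (uniformizer_max uz').
  by apply: localM => //; exact: value_at_local (value_atXz n c0 cP).
rewrite expfzMl -expfV; have := expfz_neq0 n z0.
by move: (z ^ n) => w w0; field; rewrite dz0 w0.
Qed.

Lemma form_ord_geD p n (eta theta : Omega X) :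
  form_ord_ge p n eta -> form_ord_ge p n theta -> form_ord_ge p n (eta + theta).
Proof.
have [z uz] := uniformizer_exists p.
by rewrite !(form_ord_geE _ _ uz) mulrDl; exact: localD.
Qed.

Lemma form_ord_geZ p n g (eta : Omega X) :
  local_ring p g -> form_ord_ge p n eta -> form_ord_ge p n (g *: eta).
Proof.
have [z uz] := uniformizer_exists p.
by rewrite !(form_ord_geE _ _ uz) /GRing.scale /= -mulrA; exact: localM.
Qed.

Lemma form_ord_ge0 p n : form_ord_ge p n (0 : Omega X).
Proof.
have [z uz] := uniformizer_exists p.
by rewrite (form_ord_geE _ _ uz) mul0r; exact: local0.
Qed.

Lemma form_ord_ge_sum p n m (eta : 'I_m -> Omega X) :
  (forall i, form_ord_ge p n (eta i)) -> form_ord_ge p n (\sum_(i < m) eta i).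
Proof.
move=> H; elim/big_ind: _ => // [|x y]; [exact: form_ord_ge0 | exact: form_ord_geD].
Qed.

Lemma form_ord_ge_diff p g : local_ring p g -> form_ord_ge p 0 (diff g).
Proof.
have [z uz] := uniformizer_exists p; have [_ H] := ddx_uniformizer uz.
by move=> /H; rewrite (form_ord_geE _ _ uz) expr0z mul1r.
Qed.

Lemma form_ord_ge0_N1 p (eta : Omega X) : form_ord_ge p 0 eta -> form_ord_ge p (-1) eta.
Proof.
have [z uz] := uniformizer_exists p; have [dz0 _] := ddx_uniformizer uz.
rewrite !(form_ord_geE _ _ uz) expr0z mul1r => H.
rewrite (_ : _ / _ = (eta : K) / 'd z * z).
  by apply: localM => //; exact: value_at_local (uniformizer_max uz).
by rewrite exprN1 invfM invrK; ring.
Qed.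

Lemma residue_at_log p (eta : Omega X) c : residue_at p eta c -> form_ord_ge p (-1) eta.
Proof.
move=> [z [h [uz lh ->]]]; have [dz0 _] := ddx_uniformizer uz.
have z0 := uniformizer_neq0 uz.
rewrite (form_ord_geE _ _ uz) /diff /GRing.scale /=.
rewrite (_ : _ / _ = c%:K + h * z).
  apply: localD; first exact: local_const.
  by apply: localM => //; exact: value_at_local (uniformizer_max uz).
by rewrite exprN1; field; rewrite dz0 z0.
Qed.

(** Were the form regular, c / z and hence z^-1 would be regular too. *)
Lemma residue_at_singular p (eta : Omega X) c :
  c != 0 -> residue_at p eta c -> ~ form_ord_ge p 0 eta.
Proof.
move=> c0 [z [h [uz lh ->]]]; have [dz0 _] := ddx_uniformizer uz.
have z0 := uniformizer_neq0 uz.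
rewrite (form_ord_geE _ _ uz) /diff /GRing.scale /= expr0z mul1r mulfK //.
move=> /localB/(_ lh); rewrite addrK => H; apply: (not_local_uniformizerV uz).
by apply/(unit_local_iff _ c0 (value_at_const p c)).
Qed.

Lemma residue_at_intro p z c g : uniformizer p z ->
  local_ring p ((g - c%:K * 'd z / z) / 'd z) -> residue_at p (g : Omega X) c.
Proof.
move=> uz lg; have [dz0 _] := ddx_uniformizer uz; have z0 := uniformizer_neq0 uz.
exists z, ((g - c%:K * 'd z / z) / 'd z); split=> //.
by rewrite /diff /GRing.scale /=; field; rewrite dz0 z0.
Qed.
End Differentials.

(** * Zeros and poles are finite in number *)

Section Finiteness.
Variables (F : numClosedFieldType) (X : hyperelliptic F).
Local Notation K := (funfield X).
Implicit Types (p : curve_point X) (g h : K) (c : F) (A B R : {poly F}).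

Definition at_infinity p := if p is InfinitePoint _ _ then true else false.

Lemma curve_point_inj : injective (fun p => (at_infinity p, chart_value p)).
Proof.
case=> [a b h|w h] [a' b' h'|w' h'] //= [].
  by move=> ea eb; subst; congr AffinePoint; exact: bool_irrelevance.
by move=> ew; subst; congr InfinitePoint; exact: bool_irrelevance.
Qed.

(** The points at infinity belong to this set vacuously. Each second coordinate is one of two square
    roots, so the explicit list [s] covers everything. *)
Lemma finite_points_over A : A != 0 ->
  finite_set [set p | ~~ at_infinity p -> root A (chart_value p).1].
Proof.
move=> A0; have [rs eA] := closed_field_poly_normal A.
have rP a : root A a -> a \in rs.
  by rewrite eA rootZ ?lead_coef_eq0 // root_prod_XsubC.
pose s : seq (bool * (F * F)) :=
  [seq (false, (a, e * sqrtC (rhs X).[a])) | a <- rs, e <- [:: 1; -1]] ++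
  [seq (true, (0, e * sqrtC (rhs X)`_(2 * genus X).+2)) | e <- [:: 1; -1]].
apply: (@sub_finite_set _ _ ((fun p => (at_infinity p, chart_value p)) @^-1` [set` s])).
  have sq b c : b ^+ 2 == c -> exists2 e, e \in [:: 1; -1] & b = e * sqrtC c.
    rewrite -{1}[c]sqrtCK eqf_sqr => /orP[] /eqP->.
      by exists 1; rewrite ?mul1r // !inE eqxx.
    by exists (-1); rewrite ?mulN1r // !inE eqxx orbT.
  case=> [a b hab|w hw] /= H; rewrite /mkset mem_cat; apply/orP; [left|right].
    have [e es ->] := sq _ _ hab.
    by apply/allpairsP; exists (a, e); split=> //=; apply: rP; exact: H.
  by have [e es ->] := sq _ _ hw; apply/mapP; exists e.
apply: finite_preimage; last exact: finite_seq.
by move=> ? ? _ _; exact: curve_point_inj.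
Qed.

Lemma affine_point_exists : exists p, ~~ at_infinity p.
Proof.
have h : sqrtC (rhs X).[0] ^+ 2 == (rhs X).[0] by rewrite sqrtCK.
by exists (AffinePoint h).
Qed.

(** All affine points share the coordinates (x, y), so a single fraction N / D serves them all; it
    is a unit away from the roots of the norms of N and D. *)
Lemma finite_nonunits g : g != 0 ->
  finite_set [set p | ~ exists2 c, c != 0 & value_at p g c].
Proof.
move=> g0; have [p0 a0] := affine_point_exists.
have [N [D [D0 e]]] := chart_generates p0 g.
have N0 : chart_poly p0 N != 0 by rewrite -e mulf_neq0.
have R0 : chart_rhs p0 = rhs X by case: (p0) a0.
have aE p M : ~~ at_infinity p -> chart_poly p M = chart_poly p0 M.
  by case: p p0 a0 {N0 e D0 R0} => // a b h [].
have aR p : ~~ at_infinity p -> chart_rhs p = rhs X by case: p.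
have [A [B [M eN]]] := poly2_reduce (rhs X) N.
have [A' [B' [M' eD]]] := poly2_reduce (rhs X) D.
pose nN := A ^+ 2 - B ^+ 2 * rhs X; pose nD := A' ^+ 2 - B' ^+ 2 * rhs X.
have nN0 : nN != 0.
  by have := @chart_poly_norm _ _ p0 N A B M; rewrite R0 => /(_ eN N0)[? []].
have nD0 : nD != 0.
  by have := @chart_poly_norm _ _ p0 D A' B' M'; rewrite R0 => /(_ eD D0)[? []].
have nND0 : nN * nD != 0 by rewrite mulf_neq0.
apply: sub_finite_set (finite_points_over nND0) => p /= H ap.
apply/negPn/negP; rewrite rootM negb_or => /andP[rN rD]; apply: H.
have := @chart_poly_norm _ _ p N A B M; rewrite aR // aE // => /(_ eN N0)[N' [_ _ vN]].
have := @chart_poly_norm _ _ p D A' B' M'; rewrite aR // aE // => /(_ eD D0)[D' [_ _ vD]].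
have {}vN : chart_poly_value p N != 0.
  by apply: contra rN => /eqP v0; rewrite /root -vN v0 mul0r.
have {}vD : chart_poly_value p D != 0.
  by apply: contra rD => /eqP v0; rewrite /root -vD v0 mul0r.
exists (chart_poly_value p N / chart_poly_value p D); first by rewrite mulf_neq0 ?invr_eq0.
by exists N, D; split; rewrite ?divfK // !aE.
Qed.
End Finiteness.

(** * Morphisms of function fields and values at points *)

Section Transport.
Variables (F : numClosedFieldType) (X Y : hyperelliptic F).
Variables (phi : {rmorphism funfield X -> funfield Y}).
Hypothesis phi_const : forall c, phi c%:K = c%:K.

Lemma morphism_horner (A : {poly F}) g :
  phi (map_poly (constf X) A).[g] = (map_poly (constf Y) A).[phi g].
Proof.
rewrite -horner_map -map_poly_comp; congr horner; apply: eq_map_poly => c /=.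
exact: phi_const.
Qed.

(** For a morphism of curves sending q to p, it is enough to check the values of the two pulled-back
    chart coordinates. *)
Lemma value_at_transport p q g c :
  value_at q (phi (chart p).1) (chart_value p).1 ->
  value_at q (phi (chart p).2) (chart_value p).2 ->
  value_at p g c -> value_at q (phi g) c.
Proof.
move=> h1 h2.
have vN N : value_at q (phi (chart_poly p N)) (chart_poly_value p N).
  elim/poly_ind: N => [|N A IH]; first by rewrite !rmorph0; exact: value_at0.
  rewrite !(rmorphD, rmorphM) /= chart_polyX chart_poly_valueX chart_polyC chart_poly_valueC.
  apply: value_atD; first exact: value_atM.
  by rewrite morphism_horner; exact: value_at_horner.
move=> [N [D [D0 e v]]].
have D0' : phi (chart_poly p D) != 0 by rewrite fmorph_eq0 chart_poly_neq0.
rewrite -[c](mulfK D0) v -[phi g](mulfK D0') -rmorphM e.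
by apply: value_atM => //; exact: value_atV.
Qed.

Lemma eq_funfield_morphism (psi : {rmorphism funfield X -> funfield Y}) :
  (forall c, psi c%:K = c%:K) -> phi coordx = psi coordx -> phi coordy = psi coordy ->
  phi =1 psi.
Proof.
move=> psi_const ex ey g.
have EA (A : {poly F}) : phi (ratfun X A%:F) = psi (ratfun X A%:F).
  elim/poly_ind: A => [|A c IH]; first by rewrite !rmorph0.
  rewrite !(rmorphD, rmorphM) /= IH.
  have := phi_const c; rewrite /constf => ->; have := psi_const c; rewrite /constf => ->.
  by move: ex; rewrite /coordx => ->.
have Er r : phi (ratfun X r) = psi (ratfun X r).
  by elim/fraction_ind: r => a b _; rewrite !fmorph_div /= !EA.
have [r [s ->]] := ff_span g.
rewrite !rmorphD !rmorphM; congr (_ + _ * _); [exact: Er | exact: Er | exact: ey].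
Qed.
End Transport.

(** Meant for x = xi and k = t': the denominator [k - x ^+ 2 - k] is -x^2, so regularity of b x and
    of b^-1 / x^2 would make x^-1 regular. *)
Lemma ramified_inverse (K : fieldType) (k x b : K) : x != 0 -> b != 0 ->
  x^-1 = - (b * x) * (b^-1 / (k - x ^+ 2 - k)).
Proof. by move=> x0 b0; rewrite addrAC subrr add0r; field; rewrite oppr_eq0 expf_neq0 // x0 b0. Qed.

Lemma even_odd_split (K : fieldType) (g h th : K) : 2 != 0 :> K -> th != 0 ->
  g = (g + h) / 2 + (g - h) / (2 * th) * th.
Proof. by move=> n2 th0; field; rewrite n2 th0. Qed.

Lemma separating_factor (K : fieldType) (z th c : K) : z != 0 ->
  z * (th + c) + (th - c) ^+ 2 = ((th + c) + (th - c) * ((th - c) / z)) * z.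
Proof. by move=> z0; field. Qed.

Lemma inv_sub_sqr_at_infinity (K : fieldType) (k x : K) : x != 0 -> k - x ^+ 2 != 0 ->
  (k - x ^+ 2)^-1 = x^-1 ^+ 2 / (k * x^-1 ^+ 2 - 1).
Proof.
move=> x0 d0; rewrite (_ : k * _ - 1 = (k - x ^+ 2) / x ^+ 2); last by field.
by field; rewrite x0 d0.
Qed.

(** For k = t' and x = xi, the left side is the pullback of the coordinate y / x^2 of E at infinity,
    and the right side is a unit times the uniformizer 1 / xi. *)
Lemma div_sub_sqr_at_infinity (K : fieldType) (k x y : K) : x != 0 -> k - x ^+ 2 != 0 ->
  y / (k - x ^+ 2) ^+ 2 = (y / x ^+ 3) / (k * x^-1 ^+ 2 - 1) ^+ 2 * x^-1.
Proof.
move=> x0 d0; rewrite (_ : k * _ - 1 = (k - x ^+ 2) / x ^+ 2); last by field.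
by field; rewrite x0 d0.
Qed.

Lemma uniformizer_scale (F : numClosedFieldType) (X : hyperelliptic F)
    (p : curve_point X) (z h : funfield X) (c : F) :
  uniformizer p z -> c != 0 -> value_at p h c -> uniformizer p (h * z).
Proof.
move=> uz c0 hc; have h0 := value_at_unit_neq0 c0 hc; split.
  apply/maximal_idealP; rewrite mulrC; apply: value_at_mul0l; first exact: uniformizer_max.
  exact: value_at_local hc.
case: uz => _ zP g /zP[k lk ->]; exists (k / h); last by rewrite mulrA divfK.
by apply: localM => //; exact: value_at_local (value_atV c0 hc).
Qed.

(** * The deck involution, and regularity along the fibres of the cover *)

Section Cover.
Variables (F : numClosedFieldType) (t t' : F) (ht : bielliptic_parameters t t').
Local Notation E := (elliptic_curve ht).
Local Notation C := (genus2_curve ht).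
Local Notation fs := (bielliptic_pullback ht).
Local Notation f := (bielliptic_map ht).
Local Notation xi := (coordx : funfield C).
Implicit Types (p : curve_point E) (P Q : curve_point C).
Implicit Types (a b : funfield E) (g h u z theta : funfield C).

Lemma pullback_const c : fs c%:K = c%:K.
Proof. by rewrite /bielliptic_pullback; case: (bielliptic_pullback_exists ht) => ? []. Qed.

Lemma pullback_x : fs coordx = t'%:K - xi ^+ 2.
Proof. by rewrite /bielliptic_pullback; case: (bielliptic_pullback_exists ht) => ? []. Qed.

Lemma pullback_y : fs coordy = coordy.
Proof. by rewrite /bielliptic_pullback; case: (bielliptic_pullback_exists ht) => ? []. Qed.

(** The right-hand side of C is even in xi, so [coordy] still squares to its image under xi -> -xi
    and the morphism lifts to the function field. *)
Fact deck_exists : {s : {rmorphism funfield C -> funfield C} |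
  [/\ forall c, s c%:K = c%:K, s coordx = - coordx & s coordy = coordy]}.
Proof.
apply: cid; pose q : {poly F} := - 'X.
have sq : size q = 2%N by rewrite size_polyN size_polyX.
pose phi : {rmorphism {poly F} -> funfield C} :=
  ratfun C \o @FracField.tofrac _ \o comp_poly q.
have phi_inj : injective phi.
  move=> a b /fmorph_inj /eqP; rewrite tofrac_eq -subr_eq0 => /eqP.
  rewrite -raddfB /= => /eqP; rewrite comp_poly_eq0 ?sq //.
  by rewrite subr_eq0 => /eqP.
have w2 : coordy ^+ 2 = phi (rhs C).
  rewrite [LHS](ff_y_sqr (model C)) /=; congr (ratfun C _%:F).
  rewrite /genus2_rhs /q !(comp_polyM, comp_polyB, comp_polyC) ?comp_polyX.
  by rewrite mulrNN -expr2.
have [s [sP sy]] := funfield_lift phi_inj w2.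
exists s; split => //; first by move=> c; rewrite sP /= comp_polyC.
by rewrite sP /= comp_polyX !rmorphN.
Qed.

Definition deck : {rmorphism funfield C -> funfield C} := sval deck_exists.

Lemma deck_const c : deck c%:K = c%:K.
Proof. by rewrite /deck; case: deck_exists => ? []. Qed.

Lemma deck_x : deck xi = - xi.
Proof. by rewrite /deck; case: deck_exists => ? []. Qed.

Lemma deck_y : deck coordy = coordy.
Proof. by rewrite /deck; case: deck_exists => ? []. Qed.

Lemma deckK : involutive deck.
Proof.
move=> g; have := @eq_funfield_morphism _ C C (deck \o deck) _ idfun _ _ _ g => /=; apply=> //.
- by move=> c /=; rewrite !deck_const.
- by rewrite /= !(deck_x, rmorphN) opprK.
- by rewrite /= !deck_y.
Qed.

Lemma deck_pullback a : deck (fs a) = fs a.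
Proof.
have := @eq_funfield_morphism _ E C (deck \o fs) _ fs _ _ _ a => /=; apply=> //.
- by move=> c /=; rewrite pullback_const deck_const.
- by move=> c; rewrite pullback_const.
- by rewrite /= pullback_x rmorphB rmorphXn /= deck_x sqrrN deck_const.
- by rewrite /= pullback_y deck_y.
Qed.

Fact deck_affine_proof (a b : F) : b ^+ 2 == (rhs C).[a] -> b ^+ 2 == (rhs C).[- a].
Proof. by move/eqP->; apply/eqP; rewrite /= /genus2_rhs !hornerE /=; ring. Qed.

Fact deck_infinite_proof (w : F) :
  w ^+ 2 == (rhs C)`_(2 * genus C).+2 -> (- w) ^+ 2 == (rhs C)`_(2 * genus C).+2.
Proof. by rewrite sqrrN. Qed.

(** The coordinate w = y / xi^3 is odd, so the two points at infinity are exchanged. *)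
Definition deck_point Q : curve_point C :=
  match Q with
  | AffinePoint a b hab => AffinePoint (deck_affine_proof hab)
  | InfinitePoint w hw => InfinitePoint (deck_infinite_proof hw)
  end.

Lemma deck_pointK : involutive deck_point.
Proof. by move=> Q; apply: curve_point_inj; case: Q => /= *; rewrite opprK. Qed.

Lemma bielliptic_map_deck Q : f (deck_point Q) = f Q.
Proof. by apply: curve_point_inj; case: Q => //= *; rewrite sqrrN. Qed.

Lemma bielliptic_fibre P Q : f P = f Q -> P = Q \/ P = deck_point Q.
Proof.
move=> /(congr1 (fun p => (at_infinity p, chart_value p))).
case: P Q => [a b h|w h] [a' b' h'|w' h'] //=.
  case=> /addrI/oppr_inj/eqP; rewrite eqf_sqr => /orP[]/eqP ea eb.
    by left; apply: curve_point_inj; rewrite /= ea eb.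
  by right; apply: curve_point_inj; rewrite /= ea eb.
have : w ^+ 2 == w' ^+ 2 by rewrite (eqP h) (eqP h').
by rewrite eqf_sqr => /orP[]/eqP ew _; [left|right]; apply: curve_point_inj; rewrite /= ew.
Qed.

Lemma infinite_value_neq0 (w : F) : w ^+ 2 == (rhs C)`_(2 * genus C).+2 -> w != 0.
Proof.
move=> /eqP h; apply/eqP => w0; move: h; rewrite w0 expr0n.
by rewrite genus2_rhs_coef6 => /esym/eqP; rewrite oppr_eq0 oner_eq0.
Qed.

Lemma elliptic_infinite_value (w : F) : w ^+ 2 == (rhs E)`_(2 * genus E).+2 -> w = 0.
Proof. by rewrite [(2 * _).+2]/= elliptic_rhs_coef4 expf_eq0 /= => /eqP. Qed.

Lemma bielliptic_map_surj p : exists Q, f Q = p.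
Proof.
case: p => [a b h|w h].
  have h' : b ^+ 2 == (rhs C).[sqrtC (t' - a)].
    rewrite (eqP h) /= /genus2_rhs /elliptic_rhs !hornerE /= !sqrtCK.
    by apply/eqP; ring.
  exists (AffinePoint h'); apply: curve_point_inj => /=; rewrite sqrtCK.
  by rewrite opprB addrC subrK.
exists (genus2_infinity ht false); apply: curve_point_inj => /=.
by rewrite (elliptic_infinite_value h).
Qed.

Lemma deck_value Q g c : value_at Q g c -> value_at (deck_point Q) (deck g) c.
Proof.
apply: value_at_transport; first exact: deck_const.
  have := value_at_chart1 (deck_point Q); case: Q => [a b h|w h] /=.
    by move=> /value_atN; rewrite opprK deck_x.
  by move=> /value_atN; rewrite oppr0 fmorphV deck_x invrN.
have := value_at_chart2 (deck_point Q); case: Q => [a b h|w h] /=; first by rewrite deck_y.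
move=> /value_atN; rewrite opprK fmorph_div deck_y rmorphXn /= deck_x.
by rewrite exprNn -signr_odd /= expr1 mulN1r invrN mulrN.
Qed.

Lemma deck_local Q g : local_ring Q g -> local_ring (deck_point Q) (deck g).
Proof. by move=> /local_ringP[c] /deck_value/value_at_local. Qed.

Lemma deck_uniformizer Q z : uniformizer Q z -> uniformizer (deck_point Q) (deck z).
Proof.
move=> uz; split.
  by apply/maximal_idealP; apply: deck_value; exact: uniformizer_max.
move=> g /maximal_idealP/deck_value; rewrite deck_pointK => /maximal_idealP g0.
case: uz => _ /(_ _ g0)[h lh e]; exists (deck h); first exact: deck_local.
by rewrite -rmorphM -e deckK.
Qed.

Lemma sqr_x_neq c : xi ^+ 2 != c%:K.
Proof.
apply/negP; rewrite -[c]sqrtCK rmorphXn /= eqf_sqr -rmorphN.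
by rewrite !(negPf (coordx_nonconst _ _)).
Qed.

Lemma pullback_x_neq0 : t'%:K - xi ^+ 2 != 0.
Proof. by rewrite subr_eq0 eq_sym sqr_x_neq. Qed.

Lemma two_neq0 (X : hyperelliptic F) : 2 != 0 :> funfield X.
Proof. by rewrite -(rmorph_nat (constf X)) fmorph_eq0 pnatr_eq0. Qed.

Section Infinity.
Variables (w : F) (hw : w ^+ 2 == (rhs C)`_(2 * genus C).+2).
Local Notation Q := (InfinitePoint hw).

Lemma infinity_denominator : value_at Q (t'%:K * xi^-1 ^+ 2 - 1) (-1).
Proof.
have h2 := value_atX 2 (value_at_chart1 Q).
have := value_atB (value_atM (value_at_const Q t') h2) (value_at1 Q).
by rewrite /= expr0n mulr0 sub0r.
Qed.

Lemma pullback_infinity1 :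
  fs (coordx^-1) = xi^-1 ^+ 2 / (t'%:K * xi^-1 ^+ 2 - 1).
Proof.
rewrite fmorphV pullback_x; exact: inv_sub_sqr_at_infinity (coordx_neq0 C) pullback_x_neq0.
Qed.

Lemma pullback_infinity2 : fs (coordy / coordx ^+ 2) =
  (coordy / xi ^+ 3) / (t'%:K * xi^-1 ^+ 2 - 1) ^+ 2 * xi^-1.
Proof.
rewrite fmorph_div rmorphXn /= pullback_x pullback_y.
exact: div_sub_sqr_at_infinity (coordx_neq0 C) pullback_x_neq0.
Qed.
End Infinity.

Lemma pullback_value Q a c : value_at (f Q) a c -> value_at Q (fs a) c.
Proof.
have n1 : -1 != 0 :> F by rewrite oppr_eq0 oner_eq0.
apply: value_at_transport; first exact: pullback_const.
  case: Q => [d b h|w h] /=.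
    rewrite pullback_x; apply: value_atB; first exact: value_at_const.
    exact: value_atX (value_at_chart1 (AffinePoint h)).
  rewrite pullback_infinity1 [X in value_at _ _ X](_ : _ = 0 ^+ 2 / (-1)); last first.
    by rewrite expr0n mul0r.
  apply: value_atM; first exact: value_atX (value_at_chart1 (InfinitePoint h)).
  exact: value_atV (infinity_denominator h).
case: Q => [d b h|w h] /=; first by rewrite pullback_y; exact: (value_at_chart2 (AffinePoint h)).
rewrite pullback_infinity2 -[X in value_at _ _ X](mulr0 (w / (-1) ^+ 2)).
apply: value_atM; last exact: (value_at_chart1 (InfinitePoint h)).
apply: value_atM; first exact: (value_at_chart2 (InfinitePoint h)).
apply: value_atV; first by rewrite expf_neq0.
exact: value_atX (infinity_denominator h).
Qed.

(** For descent: if a is not regular at f(Q), its inverse vanishes there, hence [fs a^-1] vanishes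
    at Q and [fs a] cannot be regular. *)
Lemma pullback_local Q a : local_ring Q (fs a) <-> local_ring (f Q) a.
Proof.
split; last by move=> /local_ringP[c] /pullback_value/value_at_local.
move=> la; case: (pselect (local_ring (f Q) a)) => // na.
have a0 : a != 0 by apply/eqP => a0; apply: na; rewrite a0; exact: local0.
have := pullback_value (not_local_value0 na).
rewrite fmorphV => /value_at_mul0l/(_ la).
rewrite mulVf ?fmorph_eq0 // => /(value_at_uniq (value_at1 Q))/eqP.
by rewrite oner_eq0.
Qed.

Lemma poly_x_basis (A : {poly F}) : exists a b,
  ratfun C A%:F = fs a + fs b * xi.
Proof.
elim/poly_ind: A => [|A c [a [b e]]]; first by exists 0, 0; rewrite !rmorph0 mul0r addr0.
exists (b * (t'%:K - coordx) + c%:K), a.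
rewrite !(rmorphD, rmorphM, rmorphN) /= e !pullback_const pullback_x.
rewrite -[ratfun C ('X)%:F]/xi -[ratfun C (c%:P)%:F]/(c%:K).
by move: (c%:K) (t'%:K) => k1 k2; ring.
Qed.

(** These combinations form a field containing xi and y: the inverse of u is [deck u] divided by the
    norm [u * deck u], which comes from E. *)
Lemma x_basis_span g : exists a b, g = fs a + fs b * xi.
Proof.
pose P g := exists a b, g = fs a + fs b * xi.
have [q x2] : exists q, xi ^+ 2 = fs q.
  exists (t'%:K - coordx).
  by rewrite rmorphB /= pullback_const pullback_x opprB addrC subrK.
have PD u v : P u -> P v -> P (u + v).
  move=> [a [b ->]] [c [d ->]]; exists (a + c), (b + d); rewrite !rmorphD /=; ring.
have PM u v : P u -> P v -> P (u * v).
  move=> [a [b ->]] [c [d ->]]; exists (a * c + b * d * q), (a * d + b * c).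
  rewrite !(rmorphD, rmorphM) /= -x2; ring.
have PV u : P u -> P u^-1.
  move=> [a [b e]]; have [->|u0] := eqVneq u 0.
    by exists 0, 0; rewrite invr0 rmorph0 mul0r addr0.
  have d0 : deck u != 0 by rewrite fmorph_eq0.
  have du : deck u = fs a - fs b * xi.
    by rewrite e rmorphD rmorphM /= !deck_pullback deck_x mulrN.
  have nE : u * deck u = fs (a * a - b * b * q).
    rewrite du {1}e rmorphB !rmorphM /= -x2; ring.
  have n0 : fs (a * a - b * b * q) != 0 by rewrite -nE mulf_neq0.
  have -> : u^-1 = deck u * fs (a * a - b * b * q)^-1.
    by rewrite fmorphV -nE invfM mulrCA mulfV // mulr1.
  rewrite du; exists (a * (a * a - b * b * q)^-1),
    (- b * (a * a - b * b * q)^-1).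
  rewrite !rmorphM /= rmorphN; ring.
have Pr r : P (ratfun C r).
  elim/fraction_ind: r => a b _; rewrite fmorph_div.
  by apply: PM; [|apply: PV]; exact: poly_x_basis.
have [r [s ->]] := ff_span g.
apply: PD; first exact: Pr; apply: PM; first exact: Pr.
by exists coordy, 0; rewrite rmorph0 mul0r addr0 pullback_y.
Qed.

Lemma deck_invariant g : deck g = g -> exists a, g = fs a.
Proof.
have [a [b e]] := x_basis_span g.
rewrite e rmorphD rmorphM /= !deck_pullback deck_x => /eqP.
rewrite (inj_eq (addrI _)) mulrN eq_sym -subr_eq0 opprK -mulr2n -mulr_natl mulf_eq0.
rewrite (negPf (two_neq0 C)) /= => /eqP b0.
by exists a; rewrite b0 addr0.
Qed.

Definition anti_invariant theta := theta != 0 /\ deck theta = - theta.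

Lemma anti_invariant_x : anti_invariant xi.
Proof. by split; [exact: coordx_neq0 | exact: deck_x]. Qed.

Lemma anti_invariant_basis theta g : anti_invariant theta -> exists a b,
  [/\ g = fs a + fs b * theta, fs a = (g + deck g) / 2 & fs b = (g - deck g) / (2 * theta)].
Proof.
move=> [th0 dth]; have n2 := two_neq0 C.
have [a ea] : exists a, (g + deck g) / 2 = fs a.
  by apply: deck_invariant; rewrite fmorph_div rmorphD /= deckK rmorph_nat addrC.
have [b eb] : exists b, (g - deck g) / (2 * theta) = fs b.
  apply: deck_invariant.
  rewrite fmorph_div rmorphB rmorphM /= deckK rmorph_nat dth mulrN invrN mulrN -mulNr.
  by rewrite opprB.
by exists a, b; split=> //; rewrite -ea -eb; exact: even_odd_split.
Qed.

Lemma anti_invariant_free theta a b : anti_invariant theta ->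
  fs a + fs b * theta = 0 -> a = 0 /\ b = 0.
Proof.
move=> [th0 dth] e; have := congr1 deck e.
rewrite rmorph0 rmorphD rmorphM /= !deck_pullback dth => e'.
have ea : 2 * fs a = 0 by rewrite -[RHS](addr0 0) -{1}e -e'; ring.
have a0 : fs a = 0 by apply/eqP; move/eqP: ea; rewrite mulf_eq0 (negPf (two_neq0 C)).
move/eqP: e; rewrite a0 add0r mulf_eq0 (negPf th0) orbF fmorph_eq0 => /eqP ->.
by split=> //; apply/eqP; rewrite -(fmorph_eq0 fs) a0.
Qed.

(** At a finite point xi itself works, being nonzero off the ramification. At infinity it has a
    pole, whereas y / xi^3 is odd with nonzero value w. *)
Lemma unramified_anti_invariant Q : deck_point Q <> Q ->
  exists theta c, [/\ anti_invariant theta, c != 0 & value_at Q theta c].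
Proof.
case: Q => [a b h|w h] nQ.
  exists xi, a; split; [exact: anti_invariant_x| |exact: (value_at_chart1 (AffinePoint h))].
  apply/eqP => a0; apply: nQ; apply: curve_point_inj => /=.
  by rewrite a0 oppr0.
exists (coordy / xi ^+ 3), w; split.
- split.
    exact: value_at_unit_neq0 (infinite_value_neq0 h) (value_at_chart2 (InfinitePoint h)).
  rewrite fmorph_div deck_y rmorphXn /= deck_x.
  by rewrite exprNn -signr_odd /= expr1 mulN1r invrN mulrN.
- exact: infinite_value_neq0 h.
- exact: (value_at_chart2 (InfinitePoint h)).
Qed.

(** One uniformizer of E is enough, the others being unit multiples: y where y = 0; x - x(f(Q)) =
    -(xi + a) (xi - a) at other finite points, where xi + a is a unit; y / x^2 at infinity. *)
Lemma unramified_uniformizer Q (z : funfield E) :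
  deck_point Q <> Q -> uniformizer (f Q) z -> uniformizer Q (fs z).
Proof.
move=> nQ uz; have [z0 uz0 ufz0] : exists2 z0, uniformizer (f Q) z0 & uniformizer Q (fs z0).
  case: Q nQ {uz} => [a b h|w h] nQ.
    have a0 : a != 0.
      by apply/eqP => a0; apply: nQ; apply: curve_point_inj; rewrite /= a0 oppr0.
    have [b0|b0] := eqVneq b 0.
      exists coordy; first exact: (uniformizer_chart2 (p := f (AffinePoint h))).
      by rewrite pullback_y; exact: (uniformizer_chart2 (p := AffinePoint h)).
    exists (coordx - (t' - a ^+ 2)%:K); first exact: (uniformizer_chart1 (p := f (AffinePoint h))).
    have -> : fs (coordx - (t' - a ^+ 2)%:K) = - (xi + a%:K) * (xi - a%:K).
      rewrite rmorphB /= pullback_x pullback_const rmorphB rmorphXn /=.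
      by move: (t'%:K) (a%:K) => k1 k2; ring.
    have h1 := value_at_chart1 (AffinePoint h).
    have : value_at (AffinePoint h) (- (xi + a%:K)) (- (a + a)).
      by apply: value_atN; apply: value_atD h1 _; exact: value_at_const.
    apply: uniformizer_scale; first exact: (uniformizer_chart1 (p := AffinePoint h)).
    by rewrite oppr_eq0 -mulr2n mulrn_eq0.
  have n1 : -1 != 0 :> F by rewrite oppr_eq0 oner_eq0.
  exists (coordy / coordx ^+ 2); first exact: (uniformizer_chart2 (p := f (InfinitePoint h))).
  rewrite pullback_infinity2; have w0 := infinite_value_neq0 h.
  apply: (@uniformizer_scale _ _ _ _ _ (w / (-1) ^+ 2)).
  - have := @uniformizer_chart1 _ _ (InfinitePoint h) w0.
    by rewrite /= rmorph0 subr0.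
  - by rewrite mulf_neq0 // invr_eq0 expf_neq0.
  apply: value_atM; first exact: (value_at_chart2 (InfinitePoint h)).
  apply: value_atV; first by rewrite expf_neq0.
  exact: value_atX (infinity_denominator h).
have [c c0 cP] := uniformizer_unit uz0 uz.
rewrite -(divfK (uniformizer_neq0 uz0) z) rmorphM.
exact: uniformizer_scale ufz0 c0 (pullback_value cP).
Qed.

(* The combination [z (theta + c) + (theta - c)^2], with [z] a uniformizer pulled
   back from [E], separates the two points of the fibre. *)
Lemma unramified_separation Q : deck_point Q <> Q ->
  exists u c, [/\ uniformizer Q u, c != 0 & value_at (deck_point Q) u c].
Proof.
move=> nQ; have [theta [c [[th0 dth] c0 thc]]] := unramified_anti_invariant nQ.
have [z0 uz0] := uniformizer_exists (f Q).
have uz := unramified_uniformizer nQ uz0; set z := fs z0 in uz.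
have thc' : value_at (deck_point Q) theta (- c).
  by have /value_atN := deck_value thc; rewrite dth opprK.
have zQ' : value_at (deck_point Q) z 0.
  apply: pullback_value; rewrite bielliptic_map_deck; exact: uniformizer_max.
(* At the conjugate point [theta] has value -c and z vanishes, which leaves (-2c)^2. *)
exists (z * (theta + c%:K) + (theta - c%:K) ^+ 2), ((- c - c) ^+ 2); split.
- have z1 := uniformizer_neq0 uz.
  rewrite (_ : _ + _ = ((theta + c%:K) + (theta - c%:K) * ((theta - c%:K) / z)) * z); last first.
    exact: separating_factor.
  apply: (@uniformizer_scale _ _ _ _ _ (c + c)) => //.
    by rewrite -mulr2n mulrn_eq0.
  have v0 : value_at Q (theta - c%:K) 0.
    by rewrite -(subrr c); apply: value_atB => //; exact: value_at_const.
  rewrite -[X in value_at _ _ X]addr0; apply: value_atD.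
    by apply: value_atD => //; exact: value_at_const.
  by apply: value_at_mul0l => //; exact: uniformizer_div.
- by rewrite expf_neq0 // -opprD oppr_eq0 -mulr2n mulrn_eq0.
rewrite -[X in value_at _ _ X]add0r; apply: value_atD.
  apply: value_at_mul0l => //; apply: localD; last exact: local_const.
  exact: value_at_local thc'.
by apply: value_atX; apply: value_atB => //; exact: value_at_const.
Qed.
End Cover.

(** * Frames *)

Section LineBundleFrames.
Variables (F : numClosedFieldType) (X : hyperelliptic F).
Local Notation K := (funfield X).
Implicit Types (p : curve_point X) (g u : K) (D : divisor X).

Definition generator D p u := forall g, ord_ge p (- D p) g <-> local_ring p (g / u).

Lemma local_unitV p g u c : c != 0 -> value_at p u c ->
  local_ring p g <-> local_ring p (g / u).
Proof.
move=> c0 uc; rewrite mulrC (unit_local_iff _ _ (value_atV c0 uc)) //.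
by rewrite invr_eq0.
Qed.

Lemma unit_generator D p u c : D p = 0 -> c != 0 -> value_at p u c -> generator D p u.
Proof.
move=> D0 c0 uc g; have [z uz] := uniformizer_exists p.
by rewrite (ord_geE _ _ uz) D0 oppr0 expr0z divr1; exact: local_unitV uc.
Qed.

Lemma finite_nongenerators D u : finite_set [set p | D p != 0] -> u != 0 ->
  finite_set [set p | ~ generator D p u].
Proof.
move=> fD u0; have fU := finite_nonunits u0.
apply: sub_finite_set (_ : finite_set ([set p | D p != 0] `|`
  [set p | ~ exists2 c, c != 0 & value_at p u c])); last by rewrite finite_setU.
move=> p /= ng; have [Dp|Dp] := eqVneq (D p) 0; last by left.
by right => -[c c0 uc]; apply: ng; exact: unit_generator uc.
Qed.

(** The neighbourhood consists of all points where u generates; it omits only finitely many, among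
    the support of D and the zeros and poles of u. *)
Lemma line_bundle_frame D p u : finite_set [set p | D p != 0] -> u != 0 ->
  generator D p u ->
  exists V, [/\ cofinite V, V p & local_frame (line_bundle D) V [tuple (u : K^o)]].
Proof.
move=> fD u0 gu; exists [set q | generator D q u]; split=> //.
  by rewrite /cofinite; exact: finite_nongenerators.
split=> [a|U _ UV].
  rewrite big_ord1 (tnth_nth 0) /= => /eqP; rewrite scaler_eq0 (negPf u0) orbF => /eqP a0 i.
  by rewrite ord1.
apply/seteqP; split=> g.
  move=> Eg; exists (fun=> g / u).
    by move=> _ q Uq; apply/(UV q Uq); exact: Eg.
  by rewrite big_ord1 (tnth_nth 0) /=; rewrite /GRing.scale /= divfK.
move=> [a la ->] q Uq; apply/(UV q Uq).
rewrite big_ord1 (tnth_nth 0) /=; rewrite /GRing.scale /= mulfK //; exact: la.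
Qed.
End LineBundleFrames.

(** * Independence of the pole order of a connection from the local frame *)

Section ChangeOfFrame.
Variables (F : numClosedFieldType) (X : hyperelliptic F) (W WO : lmodType (funfield X)).
Variables (tens : W -> Omega X -> WO) (nabla : W -> WO).
Hypothesis tensDl : forall v w eta, tens (v + w) eta = tens v eta + tens w eta.
Hypothesis tensZl : forall a w eta, tens (a *: w) eta = tens w (a *: eta).
Hypothesis tensDr : forall w eta theta, tens w (eta + theta) = tens w eta + tens w theta.
Hypothesis tensZr : forall a w eta, tens w (a *: eta) = a *: tens w eta.
Hypothesis nablaP : is_connection tens nabla.

Lemma tens0r w : tens w 0 = 0.
Proof. by rewrite -(scale0r (0 : Omega X)) tensZr scale0r. Qed.

Lemma tens0l eta : tens 0 eta = 0.
Proof. by rewrite -(scale0r (0 : W)) tensZl scale0r tens0r. Qed.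

Lemma tens_sumr w n (eta : 'I_n -> Omega X) :
  tens w (\sum_(i < n) eta i) = \sum_(i < n) tens w (eta i).
Proof. by apply: (big_morph (tens w)) => [eta1 eta2|]; [exact: tensDr | exact: tens0r]. Qed.

Lemma tens_suml n (w : 'I_n -> W) eta :
  tens (\sum_(i < n) w i) eta = \sum_(i < n) tens (w i) eta.
Proof.
by apply: (big_morph (tens^~ eta)) => [w1 w2|]; [exact: tensDl | exact: tens0l].
Qed.

Lemma nabla_sum n (w : 'I_n -> W) : nabla (\sum_(i < n) w i) = \sum_(i < n) nabla (w i).
Proof.
case: nablaP => nD _; apply: (big_morph nabla) => //.
by have := nD 0 0; rewrite addr0 => /(congr1 (fun v => v - nabla 0)); rewrite subrr addrK.
Qed.

Lemma frame_mem n (E : subsheaf W) V (e : n.-tuple W) U j :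
  local_frame E V e -> cofinite U -> U `<=` V -> E U (tnth e j).
Proof.
move=> [_ /(_ U)] H cU UV; rewrite H //.
exists (fun i => (i == j)%:R).
  by move=> i p _; case: (i == j); [exact: local1 | exact: local0].
rewrite (bigD1 j) //= eqxx scale1r big1 ?addr0 // => i /negPf->.
by rewrite scale0r.
Qed.

(** On the intersection the frames are exchanged by regular matrices G and H, and the new matrix is
    H (dG + A G). The first hypothesis lets the dG term, which is regular, count as having order k;
    it holds for k = 0 and k = -1. *)
Lemma connection_ord_change n (E : subsheaf W) p k V (e : n.-tuple W) (A : 'M[Omega X]_n) :
  (forall eta : Omega X, form_ord_ge p 0 eta -> form_ord_ge p k eta) ->
  cofinite V -> V p -> local_frame E V e -> connection_matrix tens nabla e A ->
  (forall i j, form_ord_ge p k (A i j)) ->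
  connection_ord_ge tens nabla n E p k.
Proof.
move=> k0 cV Vp fe eA oA V' e' cV' Vp' fe'.
have cU : cofinite (V `&` V') by rewrite /cofinite setCI finite_setU.
have /choice[G GP] : forall j, exists g : 'I_n -> funfield X,
    (forall i, local_ring p (g i)) /\ tnth e' j = \sum_(i < n) g i *: tnth e i.
  move=> j; have := frame_mem j fe' cU (@subIsetr _ _ _).
  rewrite (fe.2 _ cU (@subIsetl _ _ _)).
  by move=> [g lg eg]; exists g; split=> // i; apply: lg; split.
have /choice[H HP] : forall k, exists h : 'I_n -> funfield X,
    (forall l, local_ring p (h l)) /\ tnth e k = \sum_(l < n) h l *: tnth e' l.
  move=> j; have := frame_mem j fe cU (@subIsetl _ _ _).
  rewrite (fe'.2 _ cU (@subIsetr _ _ _)).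
  by move=> [g lg eg]; exists g; split=> // i; apply: lg; split.
exists (\matrix_(l, j) \sum_(k < n) H k l *: (diff (G j k) + \sum_(i < n) G j i *: A k i)).
  move=> j; rewrite [in nabla _](GP j).2 nabla_sum.
  have nM := nablaP.2.
  rewrite (eq_bigr (fun i => tens (tnth e i) (diff (G j i)) +
     \sum_(k < n) tens (tnth e k) (G j i *: A k i))); last first.
    move=> i _; rewrite nM eA scaler_sumr; congr (_ + _).
    by apply: eq_bigr => k' _; rewrite tensZr.
  rewrite big_split /= exchange_big /= -big_split /=.
  rewrite (eq_bigr (fun k => \sum_(l < n) tens (tnth e' l)
     (H k l *: (diff (G j k) + \sum_(i < n) G j i *: A k i)))); last first.
    move=> k' _; rewrite -tens_sumr -tensDr {1}(HP k').2 tens_suml.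
    by apply: eq_bigr => l _; rewrite tensZl.
  rewrite exchange_big /=; apply: eq_bigr => l _.
  by rewrite mxE tens_sumr.
move=> l j; rewrite mxE; apply: form_ord_ge_sum => k'.
apply: form_ord_geZ; first exact: (HP k').1.
apply: form_ord_geD; first by apply/k0/form_ord_ge_diff; exact: (GP j).1.
by apply: form_ord_ge_sum => i; apply: form_ord_geZ; [exact: (GP j).1 | exact: oA].
Qed.
End ChangeOfFrame.

(** * Stalks and local frames of the direct image of O(D) *)

Section DirectImageFrames.
Variables (F : numClosedFieldType) (t t' : F) (ht : bielliptic_parameters t t').
Local Notation E := (elliptic_curve ht).
Local Notation C := (genus2_curve ht).
Local Notation fs := (bielliptic_pullback ht).
Local Notation f := (bielliptic_map ht).
Local Notation deck := (deck ht).
Local Notation deck_point := (@deck_point _ _ _ ht).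
Local Notation xi := (coordx : funfield C).
Implicit Types (p : curve_point E) (P Q : curve_point C).
Implicit Types (a b : funfield E) (g h u z theta : funfield C).
Variable D : divisor C.
Hypothesis finD : finite_set [set Q | D Q != 0].

(** If u is a uniformizer at Q and a unit at the conjugate point, then u^n (deck u)^m has orders n
    and m at the two points. *)
Lemma unramified_generator Q : deck_point Q <> Q ->
  exists u, [/\ u != 0, generator D Q u & generator D (deck_point Q) u].
Proof.
move=> nQ; have [u [c [uu c0 uc]]] := unramified_separation nQ.
have du : uniformizer (deck_point Q) (deck u) := deck_uniformizer uu.
have dc : value_at Q (deck u) c by have := deck_value uc; rewrite deck_pointK.
have u0 := uniformizer_neq0 uu; have du0 := uniformizer_neq0 du.
set n := - D Q; set m := - D (deck_point Q).
exists (u ^ n * deck u ^ m); split; first by rewrite mulf_neq0 ?expfz_neq0.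
  move=> g; rewrite (ord_geE _ _ uu) invfM mulrA -/n.
  by apply: local_unitV (value_atXz m c0 dc); rewrite expfz_neq0.
move=> g; rewrite (ord_geE _ _ du) -/m [u ^ n * _]mulrC invfM mulrA.
by apply: local_unitV (value_atXz n c0 uc); rewrite expfz_neq0.
Qed.

(** Regularity of g at the conjugate point is regularity of [deck g] at Q, so both coefficients are
    regular at Q, 2 theta being a unit, and they descend by [pullback_local]. *)
Lemma unramified_sections Q theta c g : anti_invariant theta -> c != 0 ->
  value_at Q theta c -> local_ring Q g -> local_ring (deck_point Q) g ->
  exists a b, [/\ local_ring (f Q) a, local_ring (f Q) b & g = fs a + fs b * theta].
Proof.
move=> ath c0 thc lg lg'; have [a [b [e ea eb]]] := anti_invariant_basis g ath.
have ldg : local_ring Q (deck g) by have := deck_local lg'; rewrite deck_pointK.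
have l2 d k : d != 0 -> value_at Q k d -> local_ring Q k^-1.
  by move=> d0 kd; exact: value_at_local (value_atV d0 kd).
have n2 : 2 != 0 :> F by rewrite pnatr_eq0.
have v2 : value_at Q (2 : funfield C) 2.
  by rewrite -(rmorph_nat (constf C)); exact: value_at_const.
exists a, b; split=> //; apply/pullback_local.
  by rewrite ea; apply: localM; [exact: localD | exact: l2 v2].
rewrite eb; apply: localM; first exact: localB.
by apply: l2 (value_atM v2 thc); rewrite mulf_neq0.
Qed.

(** At infinity a fixed point would have w = -w = 0, against w^2 = -1. *)
Lemma ramified_point Q : deck_point Q = Q ->
  exists (b : F) (hb : b ^+ 2 == (rhs C).[0]), Q = AffinePoint hb.
Proof.
move=> /(congr1 (fun P => (at_infinity P, chart_value P))).
case: Q => [a b h|w h] /= []; last first.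
  move=> /eqP; rewrite eq_sym -subr_eq0 opprK -mulr2n mulrn_eq0 /=.
  by rewrite (negPf (infinite_value_neq0 h)).
move=> /eqP; rewrite eq_sym -subr_eq0 opprK -mulr2n mulrn_eq0 /= => /eqP a0.
by subst a; exists b, h.
Qed.

Lemma ramified_uniformizer Q : deck_point Q = Q ->
  uniformizer Q xi /\ uniformizer (f Q) (coordx - t'%:K).
Proof.
move=> /ramified_point[b [h ->]].
have b0 : b != 0.
  have /and5P[_ _ t0' t1' tt'] := ht.
  rewrite -sqrf_eq0 (eqP h) /= /genus2_rhs !hornerE /= expr0n /= !subr0.
  by rewrite !mulf_neq0 // subr_eq0 // eq_sym.
split.
  by have := @uniformizer_chart1 _ _ (AffinePoint h) b0; rewrite /= rmorph0 subr0.
suff -> : coordx - t'%:K = coordx - (t' - 0 ^+ 2)%:K :> funfield E.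
  exact: (uniformizer_chart1 (p := f (AffinePoint h))).
by rewrite expr0n subr0.
Qed.

(** The even part is regular as before, but the odd part cannot be divided by xi. If b had a pole,
    its inverse would be divisible by x - t' = -xi^2; with b xi regular, 1 / xi would be regular. *)
Lemma ramified_sections Q g : deck_point Q = Q -> local_ring Q g ->
  exists a b, [/\ local_ring (f Q) a, local_ring (f Q) b & g = fs a + fs b * xi].
Proof.
move=> rQ lg; have [ux uz] := ramified_uniformizer rQ.
have [a [b [e ea eb]]] := anti_invariant_basis g (anti_invariant_x ht).
have ldg : local_ring Q (deck g) by have := deck_local lg; rewrite rQ.
have n2 : 2 != 0 :> F by rewrite pnatr_eq0.
have v2 : value_at Q (2 : funfield C) 2.
  by rewrite -(rmorph_nat (constf C)); exact: value_at_const.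
have lV2 : local_ring Q (2 : funfield C)^-1 := value_at_local (value_atV n2 v2).
have la : local_ring (f Q) a.
  by apply/pullback_local; rewrite ea; apply: localM => //; exact: localD.
exists a, b; split=> //; case: (pselect (local_ring (f Q) b)) => // nb.
have lbx : local_ring Q (fs b * xi).
  rewrite (_ : _ * _ = g - fs a); last by rewrite e addrAC subrr add0r.
  by apply: localB => //; apply/pullback_local.
have b0 : b != 0 by apply/eqP => b0; apply: nb; rewrite b0; exact: local0.
have := uniformizer_div uz (not_local_value0 nb); move/pullback_local.
set k := fs _ => lk; exfalso; apply: (not_local_uniformizerV ux).
have -> : xi^-1 = - (fs b * xi) * k.
  rewrite /k fmorph_div fmorphV rmorphB /= pullback_x pullback_const.
  by apply: ramified_inverse; [exact: coordx_neq0 | rewrite fmorph_eq0].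
by apply: localM => //; exact: localN.
Qed.

(* The stalk at p of the direct image of O(D) is free on v, w. *)
Definition stalk_basis p (v w : funfield C) := forall g,
  (forall Q, f Q = p -> ord_ge Q (- D Q) g) <->
  exists a b, [/\ local_ring p a, local_ring p b & g = fs a * v + fs b * w].

Lemma stalk_basis_unramified Q u theta c : u != 0 -> generator D Q u ->
  generator D (deck_point Q) u -> anti_invariant theta -> c != 0 ->
  value_at Q theta c -> stalk_basis (f Q) u (u * theta).
Proof.
move=> u0 gu gu' ath c0 thc g; split.
  move=> og; have lg : local_ring Q (g / u) by apply/gu/og.
  have lg' : local_ring (deck_point Q) (g / u) by apply/gu'/og/bielliptic_map_deck.
  have [a [b [la lb e]]] := unramified_sections ath c0 thc lg lg'.
  by exists a, b; split=> //; rewrite -[g](divfK u0) e mulrDl -mulrA [theta * _]mulrC [_ * u]mulrC.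
move=> [a [b [la lb ->]]] P fP.
have thc' : value_at (deck_point Q) theta (- c).
  by have := value_atN (deck_value thc); case: ath => _ ->; rewrite opprK.
have e : (fs a * u + fs b * (u * theta)) / u = fs a + fs b * theta.
  by rewrite mulrDl mulfK // mulrCA [u * _]mulrC mulfK.
have H R d : f R = f Q -> value_at R theta d -> local_ring R (fs a + fs b * theta).
  move=> fR thd; apply: localD; first by apply/pullback_local; rewrite fR.
  by apply: localM; [apply/pullback_local; rewrite fR | exact: value_at_local thd].
have [->|->] := bielliptic_fibre fP.
  by apply/gu; rewrite e; exact: H thc.
by apply/gu'; rewrite e; apply: H thc'; exact: bielliptic_map_deck.
Qed.

(** The form [1 * xi] matches the pattern (u, u theta), so [direct_image_frame] serves both kinds of
    points. *)
Lemma stalk_basis_ramified Q : deck_point Q = Q -> D Q = 0 -> stalk_basis (f Q) 1 (1 * xi).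
Proof.
move=> rQ D0 g; have g1 := unit_generator D0 (oner_neq0 F) (value_at1 Q).
have [ux _] := ramified_uniformizer rQ.
split.
  move=> og; have : local_ring Q (g / 1) by apply/g1/og.
  rewrite divr1 => /(ramified_sections rQ)[a [b [la lb e]]].
  by exists a, b; split=> //; rewrite mulr1 mul1r.
move=> [a [b [la lb ->]]] P fP.
have -> : P = Q by have [|->] := bielliptic_fibre fP.
apply/g1; rewrite divr1 mulr1 mul1r; apply: localD; first exact/pullback_local.
apply: localM; first exact/pullback_local.
exact: value_at_local (uniformizer_max ux).
Qed.

(** Ramified fibres are placed in the exceptional set by its last component: an odd function cannot
    have a nonzero value at a fixed point. *)
Lemma finite_not_stalk_basis u theta : u != 0 -> anti_invariant theta ->
  finite_set [set p | ~ stalk_basis p u (u * theta)].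
Proof.
move=> u0 ath; have fG := finite_nongenerators finD u0.
have fT := finite_nonunits ath.1.
pose S := [set Q | ~ generator D Q u] `|` deck_point @` [set Q | ~ generator D Q u]
  `|` [set Q | ~ exists2 c, c != 0 & value_at Q theta c].
have fS : finite_set (f @` S).
  by apply: finite_image; rewrite !finite_setU; do !split=> //; exact: finite_image.
apply: sub_finite_set fS => p /= np; have [Q fQ] := bielliptic_map_surj p.
exists Q => //; apply: contrapT => nS; apply: np; rewrite -fQ.
have gQ : generator D Q u by apply: contrapT => ng; apply: nS; left; left.
have gQ' : generator D (deck_point Q) u.
  apply: contrapT => ng; apply: nS; left; right; exists (deck_point Q) => //.
  exact: deck_pointK.
have [c c0 thc] : exists2 c, c != 0 & value_at Q theta c.
  by apply: contrapT => ng; apply: nS; right.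
exact: stalk_basis_unramified thc.
Qed.

Local Notation EE := (direct_image f fs (line_bundle D)).
Local Notation W := (restr fs (funfield C)^o).

Lemma direct_image_sum (a : 'I_2 -> funfield E) (v w : W) :
  \sum_(i < 2) a i *: tnth [tuple v; w] i =
  (fs (a ord0) * (v : funfield C) + fs (a ord_max) * (w : funfield C) : funfield C).
Proof.
rewrite big_ord_recr big_ord1 /= !(tnth_nth 0) /=.
by congr (fs (a _) * _ + _); exact: val_inj.
Qed.

Lemma basis_unique u theta a b a' b' : u != 0 -> anti_invariant theta ->
  fs a * u + fs b * (u * theta) = fs a' * u + fs b' * (u * theta) -> a = a' /\ b = b'.
Proof.
move=> u0 ath e.
have e' : (fs (a - a') + fs (b - b') * theta) * u = 0.
  rewrite !rmorphB /=; apply/eqP; rewrite -(subr_eq0 _ 0) subr0.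
  by move/eqP: e; rewrite -subr_eq0 => /eqP <-; apply/eqP; ring.
move/eqP: e'; rewrite mulf_eq0 (negPf u0) orbF => /eqP /(anti_invariant_free ath)[].
by move=> /eqP; rewrite subr_eq0 => /eqP -> /eqP; rewrite subr_eq0 => /eqP ->.
Qed.

Lemma direct_image_frame p u theta : u != 0 -> anti_invariant theta ->
  stalk_basis p u (u * theta) ->
  exists V, [/\ cofinite V, V p & local_frame EE V [tuple (u : W); (u * theta : W)]].
Proof.
move=> u0 ath sp; exists [set q | stalk_basis q u (u * theta)]; split=> //.
  exact: finite_not_stalk_basis.
split=> [a|U _ UV].
  rewrite direct_image_sum => e i.
  have := @basis_unique u theta (a ord0) (a ord_max) 0 0 u0 ath.
  rewrite !rmorph0 !mul0r addr0 => /(_ e)[a0 a1].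
  by case: i => [[|[|//]]] h; [rewrite -a0 | rewrite -a1]; congr a; exact: val_inj.
apply/seteqP; split=> g; last first.
  move=> [a la ->] Q UQ; rewrite direct_image_sum.
  apply: (UV _ UQ _).2 (erefl _); exists (a ord0), (a ord_max).
  by split=> //; exact: la.
(* The coefficients are found once, over the function field; at each point of U uniqueness
   identifies them with the regular coefficients of the stalk. *)
move=> Eg; have [a [b [e _ _]]] := anti_invariant_basis (g / u) ath.
have eg : g = fs a * u + fs b * (u * theta).
  by rewrite -[g in LHS](divfK u0) e mulrDl -mulrA [theta * _]mulrC.
exists (fun i => if i == ord0 then a else b); last by rewrite direct_image_sum.
have lab q : U q -> local_ring q a /\ local_ring q b.
  move=> Uq; have [|a' [b' [la lb eg']]] := (UV q Uq g).1.
    by move=> Q fQ; apply: Eg; rewrite /= fQ.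
  by move: eg'; rewrite eg => /(basis_unique u0 ath)[-> ->].
by move=> i q /lab[la lb]; case: (i == ord0).
Qed.
End DirectImageFrames.

Lemma sum_ord2 (V : nmodType) (G : 'I_2 -> V) :
  \sum_(i < 2) G i = G ord0 + G ord_max.
Proof.
by rewrite big_ord_recr big_ord1 /=; congr (G _ + _); exact: val_inj.
Qed.

Lemma mx2_rel (V V' : nmodType) (P : V -> V' -> Prop) a b c d a' b' c' d' :
  P a a' -> P b b' -> P c c' -> P d d' ->
  forall i j, P (mx2 a b c d i j) (mx2 a' b' c' d' i j).
Proof.
move=> Pa Pb Pc Pd i j; rewrite !mxE.
by case: i => [[|[|//]] hi]; case: j => [[|[|//]] hj].
Qed.

Lemma mx2_all (V : nmodType) (P : V -> Prop) a b c d :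
  P a -> P b -> P c -> P d -> forall i j, P (mx2 a b c d i j).
Proof.
move=> Pa Pb Pc Pd; exact: (@mx2_rel V V (fun x _ => P x) a b c d a b c d).
Qed.

Lemma mx2_col (V : nmodType) (a b c d : V) (j : 'I_2) :
  (j = ord0 /\ mx2 a b c d ord0 j = a /\ mx2 a b c d ord_max j = c) \/
  (j = ord_max /\ mx2 a b c d ord0 j = b /\ mx2 a b c d ord_max j = d).
Proof.
rewrite !mxE; case: j => [[|[|//]] hj]; [left|right]; split=> //; exact: val_inj.
Qed.

Lemma leibniz_form (K : fieldType) (u du th dth om k dz : K) : dz != 0 ->
  du + u * om = u * k * dz ->
  du * th + u * dth + u * th * om = u * (th * k + dth / dz) * dz.
Proof.
move=> dz0 e; rewrite mulrDr mulrDl [u * (dth / dz)]mulrA divfK //.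
rewrite [u * (th * k)]mulrCA -[th * _ * dz]mulrA -e; ring.
Qed.

(** * The direct image connection and its regularity at unramified fibres *)

Section DirectImageConnection.
Variables (F : numClosedFieldType) (t t' : F) (ht : bielliptic_parameters t t').
Local Notation E := (elliptic_curve ht).
Local Notation C := (genus2_curve ht).
Local Notation fs := (bielliptic_pullback ht).
Local Notation f := (bielliptic_map ht).
Local Notation deck := (deck ht).
Local Notation deck_point := (@deck_point _ _ _ ht).
Local Notation xi := (coordx : funfield C).
Local Notation W := (restr fs (funfield C)^o).
Local Notation tensE := (direct_image_tens fs (@scalar_tens _ C)).
Implicit Types (p : curve_point E) (P Q : curve_point C).
Implicit Types (a b : funfield E) (g h u z theta : funfield C).

Local Notation dX := (ddx C (fs coordx)).

(** The universal property of differentials on E, applied to the derivation a -> d(fs a) with values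
    in the function field of C as a module over that of E. *)
Lemma ddx_pullback a : ddx C (fs a) = fs (ddx E a) * dX.
Proof.
have := @diff_universal _ E W (fun a => ddx C (fs a)).
apply=> [a1 a2|a1 a2|c]; first by rewrite rmorphD dx_funD.
  rewrite rmorphM dx_funM /GRing.scale /= /restr_scale /GRing.scale /=; congr (_ + _).
  exact: mulrC.
by rewrite pullback_const dx_fun_const.
Qed.

Lemma pullback_dx : dX = - (2 * xi).
Proof.
rewrite pullback_x ddxB expr2 dx_funM dx_fun_const dx_fun_x; ring.
Qed.

Lemma pullback_dx_neq0 : dX != 0.
Proof. by rewrite pullback_dx oppr_eq0 mulf_neq0 ?two_neq0 ?coordx_neq0. Qed.

Lemma tensE_E (w : W) (eta : Omega E) :
  tensE w eta = ((w : funfield C) * (fs (eta : funfield E) * dX) : funfield C).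
Proof. by []. Qed.

Lemma tensE_Dl (v w : W) (eta : Omega E) : tensE (v + w) eta = tensE v eta + tensE w eta.
Proof. by rewrite !tensE_E mulrDl. Qed.

Lemma tensE_Zl (a : funfield E) (w : W) (eta : Omega E) : tensE (a *: w) eta = tensE w (a *: eta).
Proof.
rewrite !tensE_E /GRing.scale /= /restr_scale /GRing.scale /= rmorphM.
by rewrite -!mulrA mulrCA.
Qed.

Lemma tensE_Dr (w : W) (eta eta' : Omega E) : tensE w (eta + eta') = tensE w eta + tensE w eta'.
Proof. by rewrite !tensE_E rmorphD mulrDl mulrDr. Qed.

Lemma tensE_Zr (a : funfield E) (w : W) (eta : Omega E) : tensE w (a *: eta) = a *: tensE w eta.
Proof.
rewrite !tensE_E /GRing.scale /= /restr_scale /GRing.scale /= rmorphM.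
by rewrite -!mulrA mulrCA.
Qed.

Variable omega : Omega C.
Local Notation nablaL := (line_connection omega).
Local Notation nablaE := (direct_image_connection fs nablaL).

Lemma nablaE_E (g : funfield C) : nablaE g = (ddx C g + g * (omega : funfield C) : funfield C).
Proof. by []. Qed.

Lemma direct_image_is_connection : is_connection tensE nablaE.
Proof.
split=> [v w|a w].
  by rewrite /= !nablaE_E dx_funD mulrDl addrACA.
rewrite [LHS](_ : _ = ddx C (fs a * w) + fs a * w * (omega : funfield C)) //.
rewrite tensE_E /GRing.scale /= /restr_scale /GRing.scale /= nablaE_E.
rewrite dx_funM ddx_pullback mulrDr !mulrA addrA; congr (_ + _ + _).
by rewrite mulrC mulrA.
Qed.

Lemma direct_image_matrix (v w : funfield C) (A11 A12 A21 A22 : funfield E) :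
  nablaE v = v * (fs A11 * dX) + w * (fs A21 * dX) ->
  nablaE w = v * (fs A12 * dX) + w * (fs A22 * dX) ->
  connection_matrix tensE nablaE [tuple (v : W); (w : W)]
    (mx2 (A11 : Omega E) A12 A21 A22).
Proof.
move=> ev ew j; rewrite sum_ord2 !tensE_E.
by have [[-> [-> ->]]|[-> [-> ->]]] := mx2_col A11 A12 A21 A22 j.
Qed.

Lemma direct_image_matrix_uniq u theta (A B : 'M[Omega E]_2) :
  u != 0 -> anti_invariant theta ->
  connection_matrix tensE nablaE [tuple (u : W); (u * theta : W)] A ->
  connection_matrix tensE nablaE [tuple (u : W); (u * theta : W)] B -> A = B.
Proof.
move=> u0 ath eA eB.
have H j : A ord0 j = B ord0 j /\ A ord_max j = B ord_max j.
  have := eA j; rewrite eB !sum_ord2 !tensE_E => e.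
  apply: (@basis_unique _ _ _ ht u theta (A ord0 j) (A ord_max j) (B ord0 j) (B ord_max j)) => //.
  apply: (mulIf pullback_dx_neq0).
  by rewrite !mulrDl !(mulrAC _ _ dX) !(mulrC (_ * dX)); exact: esym e.
apply/matrixP => i j; have [e0 e1] := H j.
case: i => [[|[|//]] hi].
  by rewrite (_ : Ordinal hi = ord0) ?e0 //; apply: val_inj.
by rewrite (_ : Ordinal hi = ord_max) ?e1 //; apply: val_inj.
Qed.

Variable D : divisor C.
Hypothesis finD : finite_set [set Q | D Q != 0].
Local Notation L := (line_bundle D).
Local Notation EE := (direct_image f fs L).

(** In the frame u the connection form is du / u + omega; omega alone refers to the section 1, which
    need not generate O(D). *)
Lemma regular_generator_form Q u : regular_connection_at scalar_tens nablaL 1 L Q ->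
  u != 0 -> generator D Q u -> form_ord_ge Q 0 (ddx C u / u + (omega : funfield C) : Omega C).
Proof.
move=> reg u0 gu; have [V [cV VQ fV]] := line_bundle_frame finD u0 gu.
have [A eA oA] := reg V _ cV VQ fV.
have := eA ord0; rewrite big_ord1 (tnth_nth 0) /= => e.
suff -> : (ddx C u / u + (omega : funfield C) : Omega C) = A ord0 ord0 by exact: oA.
have e' : ddx C u + u * (omega : funfield C) = u * (A ord0 ord0 : funfield C) by [].
by apply: (mulfI u0); rewrite -e' mulrDr mulrCA mulfV // mulr1.
Qed.

Lemma direct_image_regular Q : deck_point Q <> Q ->
  regular_connection_at scalar_tens nablaL 1 L Q ->
  regular_connection_at scalar_tens nablaL 1 L (deck_point Q) ->
  regular_connection_at tensE nablaE 2 EE (f Q).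
Proof.
move=> nQ reg reg'; have [u [u0 gu gu']] := unramified_generator D nQ.
have [theta [c [ath c0 thc]]] := unramified_anti_invariant nQ.
have thc' : value_at (deck_point Q) theta (- c).
  by have := value_atN (deck_value thc); case: ath => _ ->; rewrite opprK.
have nQ' : deck_point (deck_point Q) <> deck_point Q by rewrite deck_pointK => /esym.
have [z0 uz0] := uniformizer_exists (f Q).
have uz := unramified_uniformizer nQ uz0.
have uz' : uniformizer (deck_point Q) (fs z0).
  by apply: unramified_uniformizer => //; rewrite bielliptic_map_deck.
have [dz0 _] := ddx_uniformizer uz0.
have [dz dzP] := ddx_uniformizer uz; have [_ dzP'] := ddx_uniformizer uz'.
set k := (ddx C u / u + (omega : funfield C)) / ddx C (fs z0).
have lk : local_ring Q k.
  by have := regular_generator_form reg u0 gu; rewrite (form_ord_geE _ _ uz) expr0z mul1r.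
have lk' : local_ring (deck_point Q) k.
  by have := regular_generator_form reg' u0 gu'; rewrite (form_ord_geE _ _ uz') expr0z mul1r.
have lth := value_at_local thc; have lth' := value_at_local thc'.
have [a1 [b1 [la1 lb1 e1]]] := unramified_sections ath c0 thc lk lk'.
(* The second column comes from nabla(u theta) = u (theta k + dtheta / dz) dz, whose coefficient is
   again regular at both points of the fibre. *)
have [a2 [b2 [la2 lb2 e2]]] := unramified_sections ath c0 thc
  (localD (localM lth lk) (dzP _ lth)) (localD (localM lth' lk') (dzP' _ lth')).
have [V [cV VQ fV]] := direct_image_frame finD u0 ath (stalk_basis_unramified u0 gu gu' ath c0 thc).
have ek : ddx C u + u * (omega : funfield C) = u * k * ddx C (fs z0).
  by rewrite /k -mulrA divfK // mulrDr mulrCA mulfV // mulr1.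
(* As z comes from E, so does dz; hence the matrix entries are forms on E. *)
have de a : fs (a * ddx E z0) * dX = fs a * ddx C (fs z0).
  by rewrite rmorphM -mulrA -ddx_pullback.
have lo a : local_ring (f Q) a -> form_ord_ge (f Q) 0 (a * ddx E z0 : Omega E).
  by move=> la; rewrite (form_ord_geE _ _ uz0) expr0z mul1r mulfK.
apply: (connection_ord_change tensE_Dl tensE_Zl tensE_Dr tensE_Zr direct_image_is_connection
  _ cV VQ fV
  (A := mx2 (a1 * ddx E z0 : Omega E) (a2 * ddx E z0) (b1 * ddx E z0) (b2 * ddx E z0))) => //.
  apply: direct_image_matrix.
    rewrite nablaE_E ek !de e1; ring.
  rewrite nablaE_E !de dx_funM.
  transitivity (u * (theta * k + ddx C theta / ddx C (fs z0)) * ddx C (fs z0)); last first.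
    by rewrite e2; ring.
  exact: leibniz_form.
by apply: (mx2_all (P := form_ord_ge (f Q) 0)); exact: lo.
Qed.
End DirectImageConnection.

(** Here X = xi, Y = y, k = t', [- (2 * X)] is dx / dxi and t' - x = xi^2. Since x_i - x = xi^2 -
    xi_i^2, the identity 1 / (xi - xi_i) = (xi + xi_i) / (x_i - x) separates the parts of omega that
    give A11 and A21. *)
Lemma direct_image_matrix_col1 (K : fieldType) (X Y k c1 c2 y1 y2 l1 l2 : K) :
  2 != 0 :> K -> Y != 0 -> X != 0 -> X - c1 != 0 -> X + c1 != 0 ->
  X - c2 != 0 -> X + c2 != 0 ->
  (2^-1 * ((Y + y1) / (X - c1) + (Y + y2) / (X - c2)) / Y) + l1 / Y + l2 * X / Y =
  (- 2^-1 * (2^-1 * ((Y + y1) / (k - c1 ^+ 2 - (k - X ^+ 2))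
     + (Y + y2) / (k - c2 ^+ 2 - (k - X ^+ 2))) + l2) / Y) * - (2 * X) +
  X * ((- 2^-1 * (2^-1 * ((Y + y1) * c1 / ((k - c1 ^+ 2 - (k - X ^+ 2)) * (k - (k - X ^+ 2)))
     + (Y + y2) * c2 / ((k - c2 ^+ 2 - (k - X ^+ 2)) * (k - (k - X ^+ 2))))
     + l1 / (k - (k - X ^+ 2))) / Y) * - (2 * X)).
Proof.
move=> n2 Y0 X0 m1 p1 m2 p2.
have e c : k - c ^+ 2 - (k - X ^+ 2) = (X - c) * (X + c) by ring.
have e' : k - (k - X ^+ 2) = X * X by ring.
by rewrite !e e'; field; rewrite n2 Y0 X0 m1 p1 m2 p2.
Qed.

(** The summand 1 is the dxi of nabla(xi) = dxi + xi omega; it produces the extra term y / (t' - x)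
    of A22. *)
Lemma direct_image_matrix_col2 (K : fieldType) (X Y k c1 c2 y1 y2 l1 l2 : K) :
  2 != 0 :> K -> Y != 0 -> X != 0 -> X - c1 != 0 -> X + c1 != 0 ->
  X - c2 != 0 -> X + c2 != 0 ->
  1 + X * ((2^-1 * ((Y + y1) / (X - c1) + (Y + y2) / (X - c2)) / Y) + l1 / Y + l2 * X / Y) =
  (- 2^-1 * (2^-1 * ((Y + y1) * c1 / (k - c1 ^+ 2 - (k - X ^+ 2))
     + (Y + y2) * c2 / (k - c2 ^+ 2 - (k - X ^+ 2))) + l1) / Y) * - (2 * X) +
  X * ((- 2^-1 * (2^-1 * ((Y + y1) / (k - c1 ^+ 2 - (k - X ^+ 2))
     + (Y + y2) / (k - c2 ^+ 2 - (k - X ^+ 2))) + l2 + Y / (k - (k - X ^+ 2))) / Y)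
       * - (2 * X)).
Proof.
move=> n2 Y0 X0 m1 p1 m2 p2.
have e c : k - c ^+ 2 - (k - X ^+ 2) = (X - c) * (X + c) by ring.
have e' : k - (k - X ^+ 2) = X * X by ring.
by rewrite !e e'; field; rewrite n2 Y0 X0 m1 p1 m2 p2.
Qed.

Lemma polar_part21 (K : fieldType) (n1 n2 d1 d2 l k x y : K) :
  2 != 0 :> K -> d1 != 0 -> d2 != 0 -> y != 0 -> x - k != 0 ->
  - 2^-1 * (2^-1 * (n1 / (d1 * (k - x)) + n2 / (d2 * (k - x))) + l / (k - x)) / y =
  (2^-1 * (2^-1 * (n1 / d1 + n2 / d2) + l) / y) / (x - k).
Proof.
move=> t0 d10 d20 y0 z0; rewrite -(opprB x k).
by field; rewrite oppr_eq0 t0 d10 d20 y0 z0.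
Qed.

(** The y of the last summand cancels the denominator of dx / y, so the residue is 1/2 at both
    branch points. *)
Lemma polar_part22 (K : fieldType) (S k x y : K) :
  2 != 0 :> K -> y != 0 -> x - k != 0 ->
  - 2^-1 * (S + y / (k - x)) / y = - 2^-1 * S / y + 2^-1 / (x - k).
Proof.
move=> t0 y0 z0; rewrite -(opprB x k).
by field; rewrite oppr_eq0 t0 y0 z0.
Qed.

Lemma scale_dx (F : numClosedFieldType) (X : hyperelliptic F) (g : funfield X) :
  g *: diff (coordx : funfield X) = g :> Omega X.
Proof. by rewrite /diff dx_fun_x /GRing.scale /= mulr1. Qed.

(** * Residues of the explicit matrix *)

Section Residues.
Variables (F : numClosedFieldType) (X : hyperelliptic F) (p : curve_point X) (a b : F).
Variables (x1 y1 x2 y2 m1 m2 l : F).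
Local Notation x := (coordx : funfield X).
Local Notation y := (coordy : funfield X).
Hypotheses (uz : uniformizer p (x - a%:K)) (xP : value_at p x a) (yP : value_at p y b).
Hypotheses (b0 : b != 0) (x1a : x1 - a != 0) (x2a : x2 - a != 0).

Let n2 : 2 != 0 :> F. Proof. by rewrite pnatr_eq0. Qed.
Let v2 : value_at p (2^-1 : funfield X) 2^-1.
Proof.
have -> : 2^-1 = (2^-1)%:K :> funfield X by rewrite fmorphV rmorph_nat.
exact: value_at_const.
Qed.

Let vfrac c d : c - a != 0 -> value_at p ((y + d%:K) / (c%:K - x)) ((b + d) / (c - a)).
Proof.
move=> ca; apply: value_atM; first by apply: value_atD => //; exact: value_at_const.
by apply: value_atV => //; apply: value_atB => //; exact: value_at_const.
Qed.

Let vfracm c d m : c - a != 0 ->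
  value_at p ((y + d%:K) * m%:K / (c%:K - x)) ((b + d) * m / (c - a)).
Proof.
move=> ca; rewrite mulrAC [X in value_at p _ X]mulrAC.
by apply: value_atM; [exact: vfrac | exact: value_at_const].
Qed.

Lemma value_at_column (g1 g2 : funfield X) c1 c2 : value_at p g1 c1 -> value_at p g2 c2 ->
  value_at p (2^-1 * (2^-1 * (g1 + g2) + l%:K) / y) (2^-1 * (2^-1 * (c1 + c2) + l) / b).
Proof.
move=> h1 h2; apply: value_atM; last exact: value_atV.
apply: value_atM => //; apply: value_atD; last exact: value_at_const.
by apply: value_atM => //; exact: value_atD.
Qed.

Lemma residue_regular (g : funfield X) : local_ring p g -> residue_at p (g : Omega X) 0.
Proof.
move=> lg; apply: (residue_at_intro uz).
by rewrite rmorph0 !mul0r subr0 ddxB dx_fun_const dx_fun_x subr0 divr1.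
Qed.

Lemma local_entry1 : local_ring p (- 2^-1 *
  (2^-1 * ((y + y1%:K) / (x1%:K - x) + (y + y2%:K) / (x2%:K - x)) + l%:K) / y).
Proof.
rewrite !mulNr; apply: localN.
exact: value_at_local (value_at_column (vfrac y1 x1a) (vfrac y2 x2a)).
Qed.

Lemma local_entry2 : local_ring p (- 2^-1 * (2^-1 * ((y + y1%:K) * m1%:K / (x1%:K - x)
     + (y + y2%:K) * m2%:K / (x2%:K - x)) + l%:K) / y).
Proof.
rewrite !mulNr; apply: localN.
exact: value_at_local (value_at_column (vfracm y1 m1 x1a) (vfracm y2 m2 x2a)).
Qed.

(** The difference g - c vanishes at p, so its quotient by the uniformizer x - a is regular, and d(x
    - a) = dx. *)
Lemma residue_simple_pole (g : funfield X) c :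
  value_at p g c -> residue_at p (g / (x - a%:K) : Omega X) c.
Proof.
move=> gc; apply: (residue_at_intro uz).
rewrite ddxB dx_fun_const dx_fun_x subr0 divr1 mulr1 -mulrBl.
apply: uniformizer_div => //; rewrite -(subrr c).
by apply: value_atB => //; exact: value_at_const.
Qed.

Lemma residue_entry21 : residue_at p
  (- 2^-1 * (2^-1 * ((y + y1%:K) * m1%:K / ((x1%:K - x) * (a%:K - x))
     + (y + y2%:K) * m2%:K / ((x2%:K - x) * (a%:K - x))) + l%:K / (a%:K - x)) / y : Omega X)
  (2^-1 * (2^-1 * ((b + y1) * m1 / (x1 - a) + (b + y2) * m2 / (x2 - a)) + l) / b).
Proof.
have d c : c%:K - x != 0.
  by rewrite subr_eq0 eq_sym coordx_nonconst.
rewrite polar_part21 ?two_neq0 ?d ?(value_at_unit_neq0 b0 yP)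
  ?(uniformizer_neq0 uz) //.
exact/residue_simple_pole/value_at_column/vfracm/x2a/vfracm.
Qed.

Lemma residue_entry22 : residue_at p
  (- 2^-1 * (2^-1 * ((y + y1%:K) / (x1%:K - x) + (y + y2%:K) / (x2%:K - x)) + l%:K
     + y / (a%:K - x)) / y : Omega X) 2^-1.
Proof.
rewrite polar_part22 ?two_neq0 ?(value_at_unit_neq0 b0 yP) ?(uniformizer_neq0 uz) //.
apply: (residue_at_intro uz).
rewrite ddxB dx_fun_const dx_fun_x subr0 divr1 mulr1 fmorphV rmorph_nat addrK.
exact: local_entry1.
Qed.
End Residues.

(** * Branch points, the bundle structure and the basis (1, xi) *)

Section BranchPoints.
Variables (F : numClosedFieldType) (t t' : F) (ht : bielliptic_parameters t t').
Local Notation E := (elliptic_curve ht).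
Local Notation C := (genus2_curve ht).
Local Notation fs := (bielliptic_pullback ht).
Local Notation f := (bielliptic_map ht).
Local Notation deck_point := (@deck_point _ _ _ ht).
Variables (y0 : F) (hy0 : y0 ^+ 2 = t' * (t' - 1) * (t' - t)).
Implicit Types (Q : curve_point C).

Lemma branch_value_neq0 : y0 != 0.
Proof.
have /and5P[_ _ t0' t1' tt'] := ht.
by rewrite -sqrf_eq0 hy0 !mulf_neq0 // subr_eq0 // eq_sym.
Qed.

Lemma ramified_branch Q : deck_point Q = Q <-> exists s, f Q = branch_point ht hy0 s.
Proof.
split.
  move=> /ramified_point[b [hb ->]].
  have : b ^+ 2 == y0 ^+ 2.
    by rewrite (eqP hb) hy0 /= /genus2_rhs !hornerE /= expr0n /= !subr0.
  rewrite eqf_sqr => /orP[]/eqP eb; [exists false|exists true];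
    apply: curve_point_inj; rewrite /= expr0n subr0 eb ?expr0 ?expr1 ?mul1r ?mulN1r //.
move=> [s /(congr1 (fun P => (at_infinity P, chart_value P)))].
case: Q => [a b h|w h] //= [/eqP ea eb]; apply: curve_point_inj => /=.
move: ea; rewrite -subr_eq0 addrAC subrr add0r oppr_eq0 expf_eq0 /= => /eqP->.
by rewrite oppr0.
Qed.

Variable D : divisor C.
Hypothesis finD : finite_set [set Q | D Q != 0].
Hypothesis ramD : forall Q, deck_point Q = Q -> D Q = 0.
Local Notation EE := (direct_image f fs (line_bundle D)).
Local Notation W := (restr fs (funfield C)^o).

Lemma ramified_frame Q : deck_point Q = Q -> exists V, [/\ cofinite V, V (f Q) &
  local_frame EE V [tuple ((1 : funfield C) : W); ((coordx : funfield C) : W)]].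
Proof.
move=> rQ; have := @direct_image_frame _ _ _ ht D finD (f Q) 1 coordx
  (oner_neq0 _) (anti_invariant_x ht) (stalk_basis_ramified rQ (ramD rQ)).
by rewrite mul1r.
Qed.

Lemma direct_image_vector_bundle : vector_bundle 2 EE.
Proof.
move=> p; have [Q <-] := bielliptic_map_surj p.
have [rQ|nQ] := pselect (deck_point Q = Q).
  by have [V [cV VQ fV]] := ramified_frame rQ; eexists; eexists; split; eassumption.
have [u [u0 gu gu']] := unramified_generator D nQ.
have [theta [c [ath c0 thc]]] := unramified_anti_invariant nQ.
have [V [cV VQ fV]] := direct_image_frame finD u0 ath (stalk_basis_unramified u0 gu gu' ath c0 thc).
by eexists; eexists; split; eassumption.
Qed.

Lemma direct_image_generic_basis :
  generic_basis [tuple ((1 : funfield C) : W); ((coordx : funfield C) : W)].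
Proof.
move=> w; have [a [b e]] := x_basis_span (w : funfield C).
exists [ffun i => if i == ord0 then a else b]; split.
  by rewrite direct_image_sum !ffunE /= mulr1.
move=> a'; rewrite direct_image_sum [w]e mulr1 => e'.
have := @basis_unique _ _ _ ht 1 coordx a b (a' ord0) (a' ord_max)
  (oner_neq0 _) (anti_invariant_x ht).
rewrite !mulr1 !mul1r => /(_ e')[ea eb].
apply/ffunP => i; rewrite ffunE; case: i => [[|[|//]] hi] /=.
  by rewrite ea; congr (a' _); exact: val_inj.
by rewrite eb; congr (a' _); exact: val_inj.
Qed.
End BranchPoints.

(** * The explicit matrix in the basis (1, xi) *)

Section ExplicitMatrix.
Variables (F : numClosedFieldType) (t t' : F) (ht : bielliptic_parameters t t').
Variables (xi1 y1 xi2 y2 lam1 lam2 : F).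
Local Notation E := (elliptic_curve ht).
Local Notation C := (genus2_curve ht).
Local Notation fs := (bielliptic_pullback ht).
Local Notation W := (restr fs (funfield C)^o).
Local Notation x := (coordx : funfield E).
Local Notation y := (coordy : funfield E).
Local Notation x1 := (t' - xi1 ^+ 2).
Local Notation x2 := (t' - xi2 ^+ 2).

(** The coefficient of dxi in omega, since a form h dxi is represented by h. *)
Definition bielliptic_form : funfield C :=
  2^-1 * ((coordy + y1%:K) / (coordx - xi1%:K) + (coordy + y2%:K) / (coordx - xi2%:K)) / coordy
  + lam1%:K / coordy + lam2%:K * coordx / coordy.

Lemma coordy_neq0 (X : hyperelliptic F) : (coordy : funfield X) != 0.
Proof.
apply/eqP => y0; have := coordy_sqr X; rewrite y0 expr0n /= -ratfun_poly => /esym/eqP.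
by rewrite fmorph_eq0 tofrac_eq0; apply/negP/rhs_neq0.
Qed.

Lemma direct_image_bielliptic_matrix :
  connection_matrix (direct_image_tens fs (@scalar_tens _ C))
    (direct_image_connection fs (line_connection (bielliptic_form : Omega C)))
    [tuple ((1 : funfield C) : W); ((coordx : funfield C) : W)]
    (mx2 (- 2^-1 * (2^-1 * ((y + y1%:K) / (x1%:K - x) + (y + y2%:K) / (x2%:K - x))
        + lam2%:K) / y : Omega E)
     (- 2^-1 * (2^-1 * ((y + y1%:K) * xi1%:K / (x1%:K - x)
        + (y + y2%:K) * xi2%:K / (x2%:K - x)) + lam1%:K) / y)
     (- 2^-1 * (2^-1 * ((y + y1%:K) * xi1%:K / ((x1%:K - x) * (t'%:K - x))
        + (y + y2%:K) * xi2%:K / ((x2%:K - x) * (t'%:K - x))) + lam1%:K / (t'%:K - x)) / y)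
     (- 2^-1 * (2^-1 * ((y + y1%:K) / (x1%:K - x) + (y + y2%:K) / (x2%:K - x)) + lam2%:K
        + y / (t'%:K - x)) / y)).
Proof.
have n2 := two_neq0 C; have Y0 := coordy_neq0 C; have X0 := coordx_neq0 C.
have m c : (coordx : funfield C) - c%:K != 0 by rewrite subr_eq0 coordx_nonconst.
have q c : (coordx : funfield C) + c%:K != 0 by rewrite -[c]opprK rmorphN; exact: m.
have e1 c d : fs ((y + d%:K) / ((t' - c ^+ 2)%:K - x)) =
    (coordy + d%:K) / (t'%:K - c%:K ^+ 2 - (t'%:K - coordx ^+ 2)).
  by rewrite fmorph_div rmorphD rmorphB /= pullback_y pullback_x !pullback_const rmorphB rmorphXn.
have e2 c d k : fs ((y + d%:K) * k%:K / ((t' - c ^+ 2)%:K - x)) =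
    (coordy + d%:K) * k%:K / (t'%:K - c%:K ^+ 2 - (t'%:K - coordx ^+ 2)).
  by rewrite mulrAC rmorphM /= e1 pullback_const mulrAC.
have e3 c d k : fs ((y + d%:K) * k%:K / (((t' - c ^+ 2)%:K - x) * (t'%:K - x))) =
    (coordy + d%:K) * k%:K /
      ((t'%:K - c%:K ^+ 2 - (t'%:K - coordx ^+ 2)) * (t'%:K - (t'%:K - coordx ^+ 2))).
  rewrite invfM mulrA fmorph_div e2 rmorphB /= pullback_x pullback_const.
  by rewrite [in RHS]invfM [in RHS]mulrA.
have f2 : fs (- 2^-1) = - 2^-1 by rewrite rmorphN fmorphV rmorph_nat.
have g2 : fs 2^-1 = 2^-1 by rewrite fmorphV rmorph_nat.
apply: direct_image_matrix; rewrite nablaE_E pullback_dx.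
  rewrite ddx1 add0r !mul1r.
  rewrite !fmorph_div ![fs (- 2^-1 * _)]rmorphM /= f2.
  rewrite ![fs (_ + lam2%:K)]rmorphD ![fs (_ + _ / (t'%:K - x))]rmorphD /=.
  rewrite ![fs (2^-1 * _)]rmorphM /= g2.
  rewrite ![fs (_ / _ + _ / _)]rmorphD /= !e1 !e3 fmorph_div rmorphB /= pullback_y pullback_x.
  rewrite !pullback_const.
  exact: direct_image_matrix_col1.
rewrite dx_fun_x mul1r.
rewrite !fmorph_div ![fs (- 2^-1 * _)]rmorphM /= f2.
rewrite ![fs (_ + y / (t'%:K - x))]rmorphD ![fs (_ + _%:K)]rmorphD /=.
rewrite ![fs (2^-1 * _)]rmorphM /= g2.
rewrite ![fs (_ / _ + _ / _)]rmorphD /= !e1 !e2 fmorph_div rmorphB /= pullback_y pullback_x.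
rewrite !pullback_const.
exact: direct_image_matrix_col2.
Qed.
End ExplicitMatrix.

(** The denominator of dx / y takes the value eps y0 at the branch point, and 1 / (eps y0) = eps /
    y0 for a sign eps. Both terms inherit this factor, so the bracket carries eps / (4 y0), where
    the formula in words has a bare 1/4. *)
Lemma residue_entry21_branch (F : numClosedFieldType) (y0 k1 k2 d1 d2 y1 y2 l : F) (s : bool) :
  y0 != 0 -> d1 != 0 -> d2 != 0 ->
  2^-1 * (2^-1 * (((-1) ^+ s * y0 + y1) * k1 / d1 + ((-1) ^+ s * y0 + y2) * k2 / d2) + l)
    / ((-1) ^+ s * y0) =
  (-1) ^+ s / (4 * y0) * ((y1 + (-1) ^+ s * y0) * k1 / d1 + (y2 + (-1) ^+ s * y0) * k2 / d2)
    + (-1) ^+ s * (l / (2 * y0)).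
Proof.
move=> y00 d10 d20.
by case: s; rewrite ?expr1 ?expr0; field; rewrite y00 d10 d20.
Qed.

Theorem proposition7 (R : realType) (t t' : R[i])
    (ht : bielliptic_parameters t t')
    (xi1 y1 xi2 y2 lam1 lam2 y0 : R[i])
    (hq1 : y1 ^+ 2 = (t' - xi1 ^+ 2) * (t' - 1 - xi1 ^+ 2) * (t' - t - xi1 ^+ 2))
    (hq2 : y2 ^+ 2 = (t' - xi2 ^+ 2) * (t' - 1 - xi2 ^+ 2) * (t' - t - xi2 ^+ 2))
    (hy0 : y0 ^+ 2 = t' * (t' - 1) * (t' - t)) :
  let E := elliptic_curve ht in
  let C := genus2_curve ht in
  let f : curve_point C -> curve_point E := bielliptic_map ht in
  let fs : {rmorphism funfield E -> funfield C} := bielliptic_pullback ht in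
  let q1 : curve_point C := genus2_point ht hq1 in
  let q2 : curve_point C := genus2_point ht hq2 in
  let inftyp : curve_point C := genus2_infinity ht false in
  let inftym : curve_point C := genus2_infinity ht true in
  let L : subsheaf (funfield C)^o :=
    line_bundle (point_divisor q1 + point_divisor q2
                 - point_divisor inftyp - point_divisor inftym) in
  let omega : Omega C :=
    let xi : funfield C := coordx in
    let y : funfield C := coordy in
    (2^-1 * ((y + y1%:K) / (xi - xi1%:K) + (y + y2%:K) / (xi - xi2%:K)) / y)
      *: diff xi
    + (lam1%:K / y) *: diff xi + (lam2%:K * xi / y) *: diff xi in
  let nablaL : (funfield C)^o -> Omega C := line_connection omega in
  (forall P, regular_connection_at scalar_tens nablaL 1 L P) ->
  xi1 != 0 -> xi2 != 0 ->
  let EE := direct_image f fs L in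
  let tensE := direct_image_tens fs (@scalar_tens _ C) in
  let nablaE := direct_image_connection fs nablaL in
  let p (s : bool) : curve_point E := branch_point ht hy0 s in
  let x1 := t' - xi1 ^+ 2 in
  let x2 := t' - xi2 ^+ 2 in
  let x : funfield E := coordx in
  let y : funfield E := coordy in
  let dx : Omega E := diff x in
  let A11 : Omega E :=
    (- 2^-1 * (2^-1 * ((y + y1%:K) / (x1%:K - x) + (y + y2%:K) / (x2%:K - x))
               + lam2%:K) / y) *: dx in
  let A12 : Omega E :=
    (- 2^-1 * (2^-1 * ((y + y1%:K) * xi1%:K / (x1%:K - x)
                       + (y + y2%:K) * xi2%:K / (x2%:K - x))
               + lam1%:K) / y) *: dx in
  let A21 : Omega E :=
    (- 2^-1 * (2^-1 * ((y + y1%:K) * xi1%:K / ((x1%:K - x) * (t'%:K - x))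
                       + (y + y2%:K) * xi2%:K / ((x2%:K - x) * (t'%:K - x)))
               + lam1%:K / (t'%:K - x)) / y) *: dx in
  let A22 : Omega E :=
    (- 2^-1 * (2^-1 * ((y + y1%:K) / (x1%:K - x) + (y + y2%:K) / (x2%:K - x))
               + lam2%:K + y / (t'%:K - x)) / y) *: dx in
  let A : 'M[Omega E]_2 := mx2 A11 A12 A21 A22 in
  let e : 2.-tuple (restr fs (funfield C)^o) :=
    [tuple (1 : funfield C); (coordx : funfield C)] in
  [/\ vector_bundle 2 EE,
      is_connection tensE nablaE,
      logarithmic_connection tensE nablaE 2 EE,
      forall P, ~ regular_connection_at tensE nablaE 2 EE P
                <-> exists s, P = p s
    & [/\ generic_basis e,
          connection_matrix tensE nablaE e A
        & forall s : bool, let eps : R[i] := (-1) ^+ s in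
            let Res : 'M[R[i]]_2 :=
              mx2 0 0
                  (eps / (4 * y0) * ((y1 + eps * y0) * xi1 / (x1 - t')
                                     + (y2 + eps * y0) * xi2 / (x2 - t'))
                   + eps * (lam1 / (2 * y0)))
                  2^-1 in
            forall i j, residue_at (p s) (A i j) (Res i j)]].
Proof.
move=> E C f fs q1 q2 inftyp inftym L omega nablaL reg xi1_0 xi2_0 EE tensE nablaE p x1 x2.
move=> x y dx A11 A12 A21 A22 A e.
pose D : divisor C := point_divisor q1 + point_divisor q2
  - point_divisor inftyp - point_divisor inftym.
have DE Q : D Q = point_divisor q1 Q + point_divisor q2 Q
  - point_divisor inftyp Q - point_divisor inftym Q by [].
have D0 Q : Q <> q1 -> Q <> q2 -> Q <> inftyp -> Q <> inftym -> D Q = 0.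
  by move=> n1 n2 n3 n4; rewrite DE /point_divisor !asboolF.
have finD : finite_set [set Q | D Q != 0].
  apply: (@sub_finite_set _ _ ([set q1] `|` [set q2] `|` [set inftyp] `|` [set inftym])).
    move=> Q /= /eqP DQ; apply: contrapT => nQ; apply: DQ; apply: D0 => eQ; apply: nQ.
    - by left; left; left.
    - by left; left; right.
    - by left; right.
    - by right.
  by rewrite !finite_setU; do !split; exact: finite_set1.
(* Ramification points are finite with xi = 0, so xi_i nonzero keeps them off the support of D. *)
have ramD Q : deck_point Q = Q -> D Q = 0.
  move=> /ramified_point[b [hb ->]]; apply: D0 => //.
    by move=> /(congr1 (@chart_value _ _))[e1 _]; move: xi1_0; rewrite -e1 eqxx.
  by move=> /(congr1 (@chart_value _ _))[e1 _]; move: xi2_0; rewrite -e1 eqxx.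
have omegaE : omega = bielliptic_form ht xi1 y1 xi2 y2 lam1 lam2 :> Omega C.
  by rewrite /omega /bielliptic_form !scale_dx.
have eA : connection_matrix tensE nablaE e A.
  rewrite /A /A11 /A12 /A21 /A22 /dx !scale_dx /nablaE /nablaL omegaE.
  exact: direct_image_bielliptic_matrix.
have conn : is_connection tensE nablaE := direct_image_is_connection omega.
have y00 := branch_value_neq0 ht hy0.
have eps0 (s : bool) : (-1) ^+ s != 0 :> R[i] by rewrite signr_eq0.
have uz s : uniformizer (p s) ((coordx : funfield E) - t'%:K).
  by apply: (@uniformizer_chart1 _ _ (p s)); rewrite /= mulf_neq0.
have xP s : value_at (p s) (coordx : funfield E) t' := value_at_chart1 (p s).
have yP s : value_at (p s) (coordy : funfield E) ((-1) ^+ s * y0) := value_at_chart2 (p s).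
have b0 (s : bool) : (-1) ^+ s * y0 != 0 by apply: mulf_neq0; [exact: eps0 | exact: y00].
have x1a : x1 - t' != 0 by rewrite /x1 addrAC subrr add0r oppr_eq0 expf_neq0.
have x2a : x2 - t' != 0 by rewrite /x2 addrAC subrr add0r oppr_eq0 expf_neq0.
have resA (s : bool) : let eps : R[i] := (-1) ^+ s in
    let Res : 'M[R[i]]_2 := mx2 0 0
       (eps / (4 * y0) * ((y1 + eps * y0) * xi1 / (x1 - t')
          + (y2 + eps * y0) * xi2 / (x2 - t')) + eps * (lam1 / (2 * y0))) 2^-1 in
    forall i j, residue_at (p s) (A i j) (Res i j).
  move=> eps Res; apply: mx2_rel; rewrite /A11 /A12 /A21 /A22 /dx scale_dx.
  - exact/residue_regular/local_entry1.
  - exact/residue_regular/local_entry2.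
  - rewrite /eps -(@residue_entry21_branch _ y0 xi1 xi2 _ _ y1 y2 lam1 s y00 x1a x2a).
    exact: residue_entry21.
  - exact: residue_entry22.
have logA s i j : form_ord_ge (p s) (-1) (A i j) by exact/residue_at_log/(resA s).
have ram Q : deck_point Q = Q <-> exists s, f Q = p s := ramified_branch hy0 Q.
have regQ Q : deck_point Q <> Q -> regular_connection_at tensE nablaE 2 EE (f Q).
  by move=> nQ; apply: (direct_image_regular (D := D) finD nQ); exact: reg.
split=> //.
- exact: (direct_image_vector_bundle finD ramD).
- move=> P; have [Q fQ] := bielliptic_map_surj P.
  have [rQ|nQ] := pselect (deck_point Q = Q).
    have [V [cV VQ fV]] := ramified_frame finD ramD rQ.
    have [s fQs] := (ram Q).1 rQ.
    have ps : P = p s by exact: etrans (esym fQ) fQs.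
    have VP : V P by rewrite -fQ.
    apply: (connection_ord_change (@tensE_Dl _ _ _ ht) (@tensE_Zl _ _ _ ht) (@tensE_Dr _ _ _ ht)
      (@tensE_Zr _ _ _ ht) conn _ cV VP fV eA).
      by move=> eta; exact: form_ord_ge0_N1.
    by rewrite ps; exact: logA.
  move=> V' e' cV' VP' fV'; rewrite -fQ in VP' *.
  have [B eB oB] := regQ Q nQ V' e' cV' VP' fV'.
  by exists B => // i j; exact: form_ord_ge0_N1.
- move=> P; have [Q fQ] := bielliptic_map_surj P; split.
    move=> nreg; rewrite -fQ; apply/ram; apply: contrapT => nQ.
    by apply: nreg; rewrite -fQ; exact: regQ.
  move=> [s ps] regP; have rQ : deck_point Q = Q by apply/ram; exists s; exact: etrans fQ ps.
  have [V [cV VQ fV]] := ramified_frame finD ramD rQ.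
  have VP : V P by rewrite -fQ.
  have [B eB oB] := regP V _ cV VP fV.
  (* A regular connection would have a regular matrix B in the frame (1, xi); freeness of the basis
     forces B = A, and the lower right residue 1/2 is a contradiction. *)
  have AB : A = B.
    have := @direct_image_matrix_uniq _ _ _ ht omega 1 coordx A B (oner_neq0 _)
      (anti_invariant_x ht).
    by rewrite mul1r; apply.
  have := resA s ord_max ord_max; rewrite AB -ps => /residue_at_singular; apply; last exact: oB.
  by rewrite !mxE /= invr_eq0 pnatr_eq0.
- by split=> //; exact: direct_image_generic_basis.
Qed.
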